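(* There is a constant $C$, not depending on $k$, such that for every $f\in\mathcal{F}^2(\mathbb{C})$, every $k\in\mathbb{Z}_+$ and every $z\in\mathbb{C}$, $$|f^{(k)}(z)|\le C\,k!\,(1+|z|)^k\,e^{|z|^2/2}\,\|f\|_{\mathcal{F}^2}.$$
   Context: $\mathcal{F}^2(\mathbb{C})$ is the Fock space of entire functions $f$ with $\|f\|_{\mathcal{F}^2}^2=\pi^{-1}\int_{\mathbb{C}}|f(z)|^2e^{-|z|^2}\,dV(z)<\infty$, where $dV$ is Lebesgue measure on $\mathbb{C}$. $\mathbb{Z}_+=\{0,1,2,\dots\}$. *)

(* Defs.v *)
From HB Require Import structures.
From mathcomp Require Import all_boot all_order all_algebra.
From mathcomp Require Import complex.
From mathcomp Require Import all_classical all_reals all_analysis.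

Set Implicit Arguments.
Unset Strict Implicit.
Unset Printing Implicit Defensive.

Import Order.TTheory GRing.Theory Num.Theory.
Import numFieldNormedType.Exports.
Export ComplexField.Normc.

Local Open Scope classical_set_scope.
Local Open Scope ring_scope.
Local Open Scope complex_scope.

(* The topology and the normed space structure of the complex plane are those
   of the numFieldType R[i], which are attached to its alias R[i]^o. The modulus
   `|z| of that structure has type R[i]; normc z is the same number in R. *)

Definition entire (R : realType) (f : R[i] -> R[i]) : Prop :=
  forall z : R[i], derivable (f : R[i]^o -> R[i]^o) z 1.

(* f^(k); the complex derivative is a total operator, given by its limit when
   the latter exists. *)
Definition cderiv (R : realType) (k : nat) (f : R[i] -> R[i]) : R[i] -> R[i] :=
  derive1n k (f : R[i] -> R[i]^o).

Section fock.
Local Open Scope ereal_scope.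

(* dV is the two-dimensional Lebesgue measure, in the coordinates
   z = x + i y. *)
Definition cintegral (R : realType) (g : R[i] -> \bar R) : \bar R :=
  \int[(@lebesgue_measure R) \x (@lebesgue_measure R)]_(p in setT)
    g (p.1 +i* p.2)%C.

Definition fock_sqnorm (R : realType) (f : R[i] -> R[i]) : \bar R :=
  (pi^-1)%:E *
  cintegral (fun z => (normc (f z) ^+ 2 * expR (- normc z ^+ 2))%:E).

Definition fock (R : realType) : set (R[i] -> R[i]) :=
  [set f | entire f /\ fock_sqnorm f < +oo].

Definition fock_norm (R : realType) (f : R[i] -> R[i]) : R :=
  Num.sqrt (fine (fock_sqnorm f)).

End fock.

(* Main.v *)
Require Import Defs.
From mathcomp Require Import all_boot all_order all_algebra.
From mathcomp Require Import complex.
From mathcomp Require Import all_classical all_reals all_analysis.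
From mathcomp Require Import measurable_realfun ring lra.

(** The bound splits into a pointwise estimate for [f] itself and Cauchy's
    estimate on a small square.

    Pointwise estimate: |f(w)| <= C1 e^{|w|^2/2} ||f||. The usual proof
    applies the mean value property to [f(z) e^{-(z-w) conj(w)}], because
    |z|^2 = |z-w|^2 + 2 Re((z-w) conj(w)) + |w|^2 turns the square of its
    modulus into |f(z)|^2 e^{-|z|^2}, up to the factor e^{|w|^2+|z-w|^2}. Here
    the exponential is replaced by the polynomial (1 - (z-w) conj(w)/n)^n,
    which for large [n] obeys the same bound near [w] up to the factor [e]
    ([normc_1subX]), so that entire functions besides [f] are only polynomials.
    Polar coordinates are replaced by rectangles: if the weighted
    integral of |f|^2 over the plane is less than [M], then by Tonelli's
    theorem there is a rectangle around [w], with each side at distance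
    between 1 and 2, such that the integral over each of the four sides is at
    most [M] ([good_rectangle]). Cauchy's formula on that rectangle, for the
    square of the modified function, bounds |f(w)|^2 ([fock_pointwise]).

    Cauchy's estimate: on the square of half side r = 1/(1+|z|) around [z] the
    exponent |u|^2/2 exceeds |z|^2/2 by at most 4, since |z| r <= 1 and
    r <= 1; and r^{-k} = (1+|z|)^k ([cauchy_estimate]).

    Both parts need Cauchy's theory for functions that are only assumed to be
    complex differentiable. It is developed for boundaries of rectangles.
    Goursat's theorem follows by repeated quartering ([bisection], [goursat]).
    Hence the boundary of a rectangle may be shrunk to that of a small
    square around a singularity ([boundary_shrink]), and such an integral
    vanishes if the singularity is bounded
    ([boundary_bounded_singularity]) and is 2 pi i for 1/(z-a)
    ([boundary_inv]). This gives [cauchy_formula]; differentiating it under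
    the integral gives all derivatives ([cderiv_cauchy]). *)

Set Implicit Arguments.
Unset Strict Implicit.
Unset Printing Implicit Defensive.
Import Order.TTheory GRing.Theory Num.Theory.
Import numFieldNormedType.Exports.
Local Open Scope classical_set_scope.
Local Open Scope ring_scope.
Local Open Scope complex_scope.

Local Notation Re := (@complex.Re _).
Local Notation Im := (@complex.Im _).

(** * The modulus *)

Section modulus.
Context {R : realType}.
Implicit Types z w : R[i].

Lemma complexD (x y u v : R) :
  (x +i* y) + (u +i* v) = (x + u) +i* (y + v).
Proof. by []. Qed.

Lemma complexB (x y u v : R) :
  (x +i* y) - (u +i* v) = (x - u) +i* (y - v).
Proof. by []. Qed.

Lemma complexM (x y u v : R) :
  (x +i* y) * (u +i* v) = (x * u - y * v) +i* (x * v + y * u).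
Proof. by []. Qed.

Lemma invc_def (x y : R) : (x +i* y)^-1 =
  (x / (x ^+ 2 + y ^+ 2)) +i* - (y / (x ^+ 2 + y ^+ 2)) :> R[i].
Proof. by []. Qed.

Lemma normc_ge0 z : 0 <= normc z.
Proof. by case: z => a b; exact: sqrtr_ge0. Qed.

Lemma normc_eq0 z : (normc z == 0) = (z == 0).
Proof.
by apply/eqP/eqP => [/eq0_normc//|->]; exact: normc0.
Qed.

Lemma normc_gt0 z : (0 < normc z) = (z != 0).
Proof. by rewrite lt0r normc_ge0 normc_eq0 andbT. Qed.

Lemma normcX z n : normc (z ^+ n) = normc z ^+ n.
Proof. by elim: n => [|n IH]; rewrite ?expr0 ?normc1// !exprS normcM IH. Qed.

Lemma normc_sqr (x y : R) : normc (x +i* y) ^+ 2 = x ^+ 2 + y ^+ 2.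
Proof. by rewrite /normc sqr_sqrtr// addr_ge0// sqr_ge0. Qed.

Lemma normc_real (x : R) : normc (x%:C) = `|x|.
Proof. by rewrite /= expr0n/= addr0 sqrtr_sqr. Qed.

Lemma normc_Re z : `|Re z| <= normc z.
Proof.
case: z => a b; rewrite -(ler_pXn2r (ltn0Sn 1)) ?nnegrE// ?normc_ge0//.
by rewrite normc_sqr /= real_normK ?num_real// lerDl sqr_ge0.
Qed.

Lemma normc_Im z : `|Im z| <= normc z.
Proof.
case: z => a b; rewrite -(ler_pXn2r (ltn0Sn 1)) ?nnegrE// ?normc_ge0//.
by rewrite normc_sqr /= real_normK ?num_real// lerDr sqr_ge0.
Qed.

Lemma normc_le_ReIm z : normc z <= `|Re z| + `|Im z|.
Proof.
case: z => a b; rewrite -(ler_pXn2r (ltn0Sn 1)) ?nnegrE ?normc_ge0 ?addr_ge0//.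
rewrite normc_sqr /= sqrrD !real_normK ?num_real//.
by rewrite -addrA [_ *+ 2 + _]addrC addrA lerDl mulrn_wge0// mulr_ge0.
Qed.

Lemma normcB z w : normc (z - w) = normc (w - z).
Proof. by rewrite -normcN opprB. Qed.

Lemma ler_normcB z w : normc (z - w) <= normc z + normc w.
Proof. by rewrite -(normcN w) le_normcD. Qed.

Lemma normc_nat n : normc (n%:R : R[i]) = n%:R.
Proof. by rewrite -(rmorph_nat (real_complex R)) normc_real normr_nat. Qed.

Lemma normc_i : normc ('i : R[i]) = 1.
Proof. by rewrite /normc expr0n add0r expr1n sqrtr1. Qed.

End modulus.

(** * Complex differentiability with real radii *)

(** A constant of its own, rather than a notation, keeps unification from
    looking through the alias [R[i]^o] into filters of difference quotients. *)
Definition cdiff (R : realType) (f : R[i] -> R[i]) (z : R[i]) : Prop :=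
  derivable (f : R[i]^o -> R[i]^o) z 1.

Section eps_delta.
Context {R : realType}.
Implicit Types (f g : R[i] -> R[i]) (z w : R[i]).

(** The topology of [R[i]^o] is given by a norm with values in [R[i]]; its balls
    are brought back to radii in [R]. *)
Lemma nbhs_normcP z (P : set R[i]) :
  nbhs (z : R[i]^o) P <->
  exists2 d : R, 0 < d & forall w, normc (w - z) < d -> P w.
Proof.
split=> [/(@nbhs_normP _ R[i]^o)[[e1 e2]/=]|[d d0 dP]].
- rewrite ltcE/= => /andP[/eqP e20 e10] H; exists e1 => // w wz.
  apply: H => /=.
  have -> : (`|(z : R[i]^o) - w| : R[i]) = (normc (z - w))%:C by [].
  by rewrite ltcE/= e20 eqxx normcB.
- apply/(@nbhs_normP _ R[i]^o); exists (d%:C); first by rewrite /= ltcR.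
  move=> w /= H; apply: dP; rewrite normcB.
  have : (normc (z - w))%:C < d%:C by exact: H.
  by rewrite ltcR.
Qed.

Lemma cvg_normcP f z l :
  (f : R[i]^o -> R[i]^o) x @[x --> (z : R[i]^o)] --> (l : R[i]^o) <->
  forall e : R, 0 < e -> exists2 d, 0 < d &
    forall w, normc (w - z) < d -> normc (f w - l) < e.
Proof.
split=> [fl e e0|H].
- have /fl : nbhs (l : R[i]^o) [set u : R[i] | normc (u - l) < e].
    by apply/nbhs_normcP; exists e.
  by rewrite /= => /nbhs_normcP.
- move=> P /nbhs_normcP[e e0 eP]; apply/nbhs_normcP.
  by have [d d0 dP] := H e e0; exists d => // w /dP/eP.
Qed.

Lemma cdiff_normcP f z : cdiff f z ->
  forall e : R, 0 < e -> exists2 d, 0 < d & forall w, normc (w - z) < d ->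
    normc (f w - f z - cderiv 1 f z * (w - z)) <= e * normc (w - z).
Proof.
move=> dfz e e0.
have : h^-1 *: ((f : R[i]^o -> R[i]^o) (h + z) - f z)
    @[h --> (0 : R[i]^o)^'] --> (cderiv 1 f z : R[i]^o).
  rewrite /cderiv derive1n1.
  have /= : derivable (f : R[i]^o -> R[i]^o) z 1 := dfz.
  rewrite /derive1 /derivable => /=.
  under [X in cvg (X @ _)]eq_fun => h do rewrite [h *: 1]mulr1.
  by [].
move=> H.
have /H : nbhs (cderiv 1 f z : R[i]^o) [set u : R[i] | normc (u - cderiv 1 f z) < e].
  by apply/nbhs_normcP; exists e.
rewrite /= => /nbhs_normcP[d d0 dP]; exists d => // w wz.
have [->|wz0] := eqVneq w z; first by rewrite !subrr mulr0 subrr normc0 mulr0.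
have wz1 : w - z != 0 by rewrite subr_eq0.
have := dP (w - z); rewrite subr0 => /(_ wz wz1).
rewrite /= -[GRing.add (w - z) z]/(w - z + z).
rewrite subrK => /ltW.
rewrite [_ *: _]/(_ * _) => K.
have -> : f w - f z - cderiv 1 f z * (w - z) =
    ((w - z)^-1 * (f w - f z) - cderiv 1 f z) * (w - z).
  by field.
by rewrite normcM ler_wpM2r// normc_ge0.
Qed.

(** The form in which derivatives are computed below: the inequality need not
    come from a closed expression for the quotient. *)
Lemma normcP_cdiff f z l :
  (forall e : R, 0 < e -> exists2 d, 0 < d & forall w, normc (w - z) < d ->
    normc (f w - f z - l * (w - z)) <= e * normc (w - z)) ->
  cdiff f z /\ cderiv 1 f z = l.
Proof.
move=> H.
have cv : h^-1 *: ((f : R[i]^o -> R[i]^o) (h + z) - f z)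
    @[h --> (0 : R[i]^o)^'] --> (l : R[i]^o).
  move=> P /nbhs_normcP[e e0 eP]; apply/nbhs_normcP.
  have e20 : 0 < e / 2 by rewrite divr_gt0.
  have [d d0 dP] := H (e / 2) e20.
  exists d => // h; rewrite subr0 => hd h0; apply: eP.
  have := dP (h + z); rewrite -[_ - z]/((h + z) - z) (_ : h + z - z = h); last by ring.
  move=> /(_ hd).
  rewrite [_ *: _]/(_ * _) => K.
  have {}h0 : h != 0 := h0.
  have h1 : 0 < normc h by rewrite normc_gt0.
  have : normc (h^-1 * (f (h + z) - f z) - l) * normc h <= e / 2 * normc h.
    rewrite -normcM (_ : _ * h = f (h + z) - f z - l * h)//.
    by field.
  rewrite ler_pM2r// => /le_lt_trans; apply.
  by rewrite ltr_pdivrMr// ltr_pMr// ltr1n.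
split.
  rewrite /cdiff /derivable; apply/cvg_ex; exists (l : R[i]^o).
  by under eq_fun => h do rewrite [h *: 1]mulr1.
by rewrite /cderiv derive1n1 /derive1; exact: (cvg_lim (@norm_hausdorff _ R[i]^o) cv).
Qed.

Lemma cdiff_cont f z : cdiff f z ->
  forall e : R, 0 < e -> exists2 d, 0 < d &
    forall w, normc (w - z) < d -> normc (f w - f z) < e.
Proof.
by rewrite /cdiff => /derivable1_diffP/differentiable_continuous/cvg_normcP.
Qed.

End eps_delta.

(** * Complex-valued integrals over a segment *)

Section segment_integral.
Context {R : realType}.
Local Notation mu := (@lebesgue_measure R).
Implicit Types (phi psi : R -> R[i]) (a b t : R) (c : R[i]).

Definition cint phi a b : R[i] :=
  (\int[mu]_(t in `[a, b]) Re (phi t)) +i* (\int[mu]_(t in `[a, b]) Im (phi t)).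

Definition cintegrable phi a b : Prop :=
  mu.-integrable `[a, b] (EFin \o (Re \o phi)) /\
  mu.-integrable `[a, b] (EFin \o (Im \o phi)).

Lemma cont_cintegrable phi a b :
  (forall t, a <= t <= b -> forall e, 0 < e -> exists2 d : R, 0 < d &
     forall s, `|s - t| < d -> normc (phi s - phi t) < e) ->
  cintegrable phi a b.
Proof.
move=> H.
have lipschitz (L : R[i] -> R) : (forall z w, `|L z - L w| <= normc (z - w)) ->
    mu.-integrable `[a, b] (EFin \o (L \o phi)).
  move=> LP; apply: continuous_compact_integrable; first exact: segment_compact.
  apply: continuous_in_subspaceT => t /set_mem /=; rewrite in_itv/= => tab.
  apply/cvgrPdist_lt => e e0.
  have [d d0 dP] := H t tab e e0.
  near=> s; apply: le_lt_trans (LP _ _) _; rewrite normcB; apply: dP.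
  by rewrite distrC; near: s; apply/nbhs_ballP; exists d.
split; apply: lipschitz => z w.
- by apply: le_trans (normc_Re _); case: z w => [? ?] [? ?].
- by apply: le_trans (normc_Im _); case: z w => [? ?] [? ?].
Unshelve. all: by end_near. Qed.

Lemma eq_cint phi psi a b : (forall t, a <= t <= b -> phi t = psi t) ->
  cint phi a b = cint psi a b.
Proof.
by move=> e; rewrite /cint; congr (_ +i* _); apply: eq_Rintegral => t;
  rewrite inE/= in_itv/= => /e ->.
Qed.

Lemma cintD phi psi a b : cintegrable phi a b -> cintegrable psi a b ->
  cint (fun t => phi t + psi t) a b = cint phi a b + cint psi a b.
Proof.
move=> [p1 p2] [q1 q2]; rewrite /cint.
rewrite complexD -!RintegralD//.
by congr (_ +i* _); apply: eq_Rintegral => t _; case: (phi t) (psi t) => [? ?] [? ?].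
Qed.

Lemma cintB phi psi a b : cintegrable phi a b -> cintegrable psi a b ->
  cint (fun t => phi t - psi t) a b = cint phi a b - cint psi a b.
Proof.
move=> [p1 p2] [q1 q2]; rewrite /cint complexB -!RintegralB//.
by congr (_ +i* _); apply: eq_Rintegral => t _ /=;
  case: (phi t) (psi t) => [? ?] [? ?].
Qed.

Lemma cintMl c phi a b : cintegrable phi a b ->
  cint (fun t => c * phi t) a b = c * cint phi a b.
Proof.
case: c => c1 c2 [p1 p2]; rewrite /cint.
have Z r f : mu.-integrable `[a, b] (EFin \o f) ->
    mu.-integrable `[a, b] (EFin \o (fun t => r * f t)).
  move=> mf; under [X in _.-integrable _ X]eq_fun do rewrite /= EFinM.
  exact: integrableZl.
have ZR r f := @RintegralZl _ _ _ mu `[a, b] f r (measurable_itv _).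
have -> : (c1 +i* c2) * ((\int[mu]_(t in `[a, b]) Re (phi t)) +i*
       (\int[mu]_(t in `[a, b]) Im (phi t))) =
  ((c1 * (\int[mu]_(t in `[a, b]) (Re \o phi) t) -
    c2 * (\int[mu]_(t in `[a, b]) (Im \o phi) t)) +i*
   (c1 * (\int[mu]_(t in `[a, b]) (Im \o phi) t) +
    c2 * (\int[mu]_(t in `[a, b]) (Re \o phi) t))).
  by [].
rewrite -!ZR//.
rewrite -RintegralB; [|by []|exact: Z|exact: Z].
rewrite -RintegralD; [|by []|exact: Z|exact: Z].
by congr (_ +i* _); apply: eq_Rintegral => t _ /=; case: (phi t) => [? ?].
Qed.

Lemma cint_split phi a m b : a <= m <= b -> cintegrable phi a b ->
  cint phi a b = cint phi a m + cint phi m b.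
Proof.
move=> /andP[am mb] [p1 p2].
have S f : mu.-integrable `[a, b] (EFin \o f) ->
   \int[mu]_(t in `[a, b]) f t =
   \int[mu]_(t in `[a, m]) f t + \int[mu]_(t in `[m, b]) f t.
  move=> mf; have := @Rintegral_itvB _ f (BLeft a) (BRight b) m mf.
  rewrite !bnd_simp => /(_ am mb) H.
  rewrite -[X in _ + X]Rintegral_itv_obnd_cbnd -?H; first by rewrite addrC subrK.
  apply: integrableS mf => //.
  by move=> x /=; rewrite !in_itv/= => /andP[mx ->]; rewrite (le_trans am)// ltW.
by rewrite /cint complexD; congr (_ +i* _); rewrite (S, S).
Qed.

(** The factor 2 comes from estimating real and imaginary parts separately. The
    sharp constant 1 would need a rotation of [phi], and only affects the final
    constant. The bound is an extended integral so that it can be compared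
    with the sections of a plane integral. *)
Lemma cint_le_integral phi (G : R -> R) a b : cintegrable phi a b ->
  measurable_fun `[a, b] G -> (forall t, a <= t <= b -> normc (phi t) <= G t) ->
  ((normc (cint phi a b))%:E <= 2%:E * \int[mu]_(t in `[a, b]) (G t)%:E)%E.
Proof.
move=> [p1 p2] mG pG.
have K f : mu.-integrable `[a, b] (EFin \o f) ->
   (forall t, a <= t <= b -> `|f t| <= G t) ->
   (`|\int[mu]_(t in `[a, b]) f t|%:E <= \int[mu]_(t in `[a, b]) (G t)%:E)%E.
  move=> mf fG; rewrite EFin_normr_Rintegral//.
  have /measurable_int mf' := mf.
  apply: le_trans (le_abse_integral _ _ _) _ => //.
  apply: ge0_le_integral => //=.
  - apply/measurable_EFinP; apply: measurableT_comp => //; exact/measurable_EFinP.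
  - exact/measurable_EFinP.
apply: (@le_trans _ _ (`|\int[mu]_(t in `[a, b]) Re (phi t)|%:E +
    `|\int[mu]_(t in `[a, b]) Im (phi t)|%:E)%E).
  by rewrite -EFinD lee_fin; exact: normc_le_ReIm.
rewrite (_ : 2%:E = 1 + 1)%E; last by rewrite -EFinD.
rewrite ge0_muleDl// !mul1e; apply: leeD; apply: K => // t /pG.
  exact/le_trans/normc_Re.
exact/le_trans/normc_Im.
Qed.

Lemma cint_le phi (M : R) a b : a <= b -> cintegrable phi a b ->
  (forall t, a <= t <= b -> normc (phi t) <= M) ->
  normc (cint phi a b) <= 2 * M * (b - a).
Proof.
move=> ab pi pM; rewrite -lee_fin.
apply: (le_trans (cint_le_integral pi (@measurable_cst _ _ _ _ _ M) pM)).
rewrite [X in (_ * X <= _)%E](_ : _ = M%:E * mu `[a, b])%E; last first.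
  exact: (@integral_cst _ _ _ mu `[a, b] (measurable_itv _) M%:E).
rewrite lebesgue_measure_itv/= lte_fin.
case: ifPn => [_|]; first by rewrite -EFinB -!EFinM mulrA.
rewrite -leNgt => ba; rewrite !mule0 lee_fin (_ : b = a) ?subrr ?mulr0//.
exact/le_anti/andP.
Qed.

Lemma cint_FTC (u v U V : R -> R) a b : a < b ->
  (forall t, is_derive t 1 U (u t)) -> (forall t, is_derive t 1 V (v t)) ->
  continuous u -> continuous v ->
  cint (fun t => u t +i* v t) a b = (U b - U a) +i* (V b - V a).
Proof.
move=> ab dU dV cu cv.
have ftc (w W : R -> R) : (forall t, is_derive t 1 W (w t)) -> continuous w ->
    \int[mu]_(t in `[a, b]) w t = W b - W a.
  move=> dW cw.
  have cW x : W x @[x --> x] --> W x.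
    by apply: differentiable_continuous; exact/derivable1_diffP/ex_derive.
  rewrite /Rintegral (@continuous_FTC2 _ _ W)//.
  - exact: continuous_subspaceT.
  - split=> [x _||]; first exact: ex_derive.
      exact: cvg_at_right_filter.
    exact: cvg_at_left_filter.
  - by move=> x _; rewrite derive1E; exact: derive_val.
by rewrite /cint /= (ftc _ _ dU cu) (ftc _ _ dV cv).
Qed.

End segment_integral.

(** * Integrals along the boundary of a rectangle *)

Section boundary_integral.
Context {R : realType}.
Implicit Types (f g : R[i] -> R[i]) (z w c : R[i]) (x y t : R).

Lemma cdiff_cst c z : cdiff (fun _ : R[i] => c) z.
Proof. exact: derivable_cst. Qed.

Lemma cdiff_id z : cdiff (fun w : R[i] => w) z.
Proof. exact: derivable_id. Qed.

Lemma cdiffD f g z : cdiff f z -> cdiff g z -> cdiff (fun w : R[i] => f w + g w) z.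
Proof. exact: derivableD. Qed.

Lemma cdiffB f g z : cdiff f z -> cdiff g z -> cdiff (fun w : R[i] => f w - g w) z.
Proof. exact: derivableB. Qed.

Lemma cdiffM f g z : cdiff f z -> cdiff g z -> cdiff (fun w : R[i] => f w * g w) z.
Proof. exact: derivableM. Qed.

Lemma cdiffX f n z : cdiff f z -> cdiff (fun w : R[i] => f w ^+ n) z.
Proof.
move=> fz; elim: n => [|n IH]; first exact: cdiff_cst.
by under [X in cdiff X]eq_fun do rewrite exprS; exact: cdiffM.
Qed.

Lemma cdiffV f z : f z != 0 -> cdiff f z -> cdiff (fun w : R[i] => (f w)^-1) z.
Proof. exact: derivableV. Qed.

Definition horizontal f x1 x2 y := cint (fun x => f (x +i* y)) x1 x2.
Definition vertical f x y1 y2 := cint (fun y => f (x +i* y)) y1 y2.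

(** The contour integral of [f(z) dz], counterclockwise: [dz] is [dx] on
    horizontal sides and [i dy] on vertical ones. *)
Definition boundary f x1 x2 y1 y2 : R[i] :=
  horizontal f x1 x2 y1 + 'i * vertical f x2 y1 y2
  - horizontal f x1 x2 y2 - 'i * vertical f x1 y1 y2.

Definition on_boundary x1 x2 y1 y2 z : Prop :=
  [/\ x1 <= Re z <= x2, y1 <= Im z <= y2 &
     [\/ Re z = x1, Re z = x2, Im z = y1 | Im z = y2]].

Definition in_rectangle x1 x2 y1 y2 z : Prop :=
  x1 <= Re z <= x2 /\ y1 <= Im z <= y2.

Lemma horizontal_integrable f x1 x2 y :
  (forall x, x1 <= x <= x2 -> cdiff f (x +i* y)) ->
  cintegrable (fun x => f (x +i* y)) x1 x2.
Proof.
move=> df; apply: cont_cintegrable => t /df dft e e0.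
have [d d0 dP] := cdiff_cont dft e0.
exists d => // s st; apply: dP.
by rewrite complexB subrr normc_real.
Qed.

Lemma vertical_integrable f x y1 y2 :
  (forall y, y1 <= y <= y2 -> cdiff f (x +i* y)) ->
  cintegrable (fun y => f (x +i* y)) y1 y2.
Proof.
move=> df; apply: cont_cintegrable => t /df dft e e0.
have [d d0 dP] := cdiff_cont dft e0.
exists d => // s st; apply: dP.
by rewrite complexB subrr /normc expr0n add0r sqrtr_sqr.
Qed.

End boundary_integral.

(** * Subdivision of rectangles *)

Section bisection.
Context {R : realType}.
Variables (P : R -> R -> R -> R -> Prop) (x1 x2 y1 y2 : R).
Hypotheses (x12 : x1 < x2) (y12 : y1 < y2).

Definition subrectangle (a b c d : R) : Prop :=
  [/\ x1 <= a, a < b, b <= x2 & [/\ y1 <= c, c < d & d <= y2]].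

Hypothesis Pquarter : forall a b c d, subrectangle a b c d ->
  P a ((a + b) / 2) c ((c + d) / 2) -> P ((a + b) / 2) b c ((c + d) / 2) ->
  P a ((a + b) / 2) ((c + d) / 2) d -> P ((a + b) / 2) b ((c + d) / 2) d ->
  P a b c d.
Hypothesis Plocal : forall p q, x1 <= p <= x2 -> y1 <= q <= y2 ->
  exists2 e, 0 < e & forall a b c d, subrectangle a b c d ->
    a <= p <= b -> c <= q <= d -> b - a < e -> d - c < e -> P a b c d.

(** A two-dimensional Cousin lemma. If [P] failed on the whole rectangle it would
    fail on a nested sequence of quarters, which shrinks to a point; there the
    local hypothesis contradicts the failure. *)
Lemma bisection : P x1 x2 y1 y2.
Proof.
apply: contrapT => nP.
pose T := (R * R * (R * R))%type.
pose bad (s : T) := subrectangle s.1.1 s.1.2 s.2.1 s.2.2 /\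
   ~ P s.1.1 s.1.2 s.2.1 s.2.2.
pose child (s t : T) := [/\ s.1.1 <= t.1.1, t.1.2 <= s.1.2, s.2.1 <= t.2.1 &
  [/\ t.2.2 <= s.2.2, t.1.2 - t.1.1 = (s.1.2 - s.1.1) / 2 &
      t.2.2 - t.2.1 = (s.2.2 - s.2.1) / 2]].
have /choice[next nextP] : forall s, exists t, bad s -> bad t /\ child s t.
  move=> [[a b] [c d]]; have [|nbad] := pselect (bad ((a, b), (c, d))); last first.
    by exists ((a, b), (c, d)).
  move=> [/= sr nPs].
  have [h1 h2 h3 [h4 h5 h6]] := sr.
  have [] : exists t : T, ~ P t.1.1 t.1.2 t.2.1 t.2.2 /\
     ((t.1 = (a, (a + b) / 2) \/ t.1 = ((a + b) / 2, b)) /\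
      (t.2 = (c, (c + d) / 2) \/ t.2 = ((c + d) / 2, d))).
    apply: contrapT => H; apply: nPs; apply: Pquarter => //;
      apply: contrapT => K; apply: H.
    - by exists ((a, (a + b) / 2), (c, (c + d) / 2)); split => //; split; left.
    - exists (((a + b) / 2, b), (c, (c + d) / 2)); split => //.
      by split; [right|left].
    - exists ((a, (a + b) / 2), ((c + d) / 2, d)); split => //.
      by split; [left|right].
    - by exists (((a + b) / 2, b), ((c + d) / 2, d)); split => //; split; right.
  move=> [[a' b'] [c' d']] /= [nPt [E1 E2]]; exists ((a', b'), (c', d')) => _.
  rewrite /bad /child /subrectangle /=.
  have [A1 A2 A3 A4] : [/\ a <= a', a' < b', b' <= b & b' - a' = (b - a) / 2].
    by case: E1 => -[-> ->]; split; lra.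
  have [B1 B2 B3 B4] : [/\ c <= c', c' < d', d' <= d & d' - c' = (d - c) / 2].
    by case: E2 => -[-> ->]; split; lra.
  by split; split => //; split; [lra|lra|lra|split; lra].
pose S n := iter n next ((x1, x2), (y1, y2)).
have badS n : bad (S n).
  elim: n => [|n IH]; last by have [] := nextP _ IH.
  by split.
have childS n : child (S n) (S n.+1) by have [] := nextP _ (badS n).
have width n : (S n).1.2 - (S n).1.1 = (x2 - x1) / 2 ^+ n /\
               (S n).2.2 - (S n).2.1 = (y2 - y1) / 2 ^+ n.
  elim: n => [|n [IH1 IH2]]; first by rewrite /= expr0 !divr1.
  have [_ _ _ [_ -> ->]] := childS n.
  by rewrite IH1 IH2 exprS invfM -!mulrA ![2^-1 * _]mulrC.
have mono m n : [/\ (S m).1.1 <= (S (m + n)%N).1.1, (S (m + n)%N).1.2 <= (S m).1.2,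
    (S m).2.1 <= (S (m + n)%N).2.1 & (S (m + n)%N).2.2 <= (S m).2.2].
  elim: n => [|n [I1 I2 I3 I4]]; first by rewrite addn0.
  have [J1 J2 J3 [J4 _ _]] := childS (m + n)%N.
  by rewrite addnS; split; lra.
have cross m n : (S m).1.1 <= (S n).1.2 /\ (S m).2.1 <= (S n).2.2.
  have [I1 I2 I3 I4] := mono m n; have := mono n m; rewrite addnC => -[J1 J2 J3 J4].
  by have [[K1 K2 K3 [K4 K5 K6]] _] := badS (m + n)%N; lra.
(* The left ends are bounded by all right ends; their supremum lies in every
   interval. *)
have supP (u v : nat -> R) : (forall m n, u m <= v n) ->
    exists p, forall n, u n <= p <= v n.
  move=> uv; exists (sup (range u)) => n; apply/andP; split.
    apply: sup_upper_bound; last by exists n.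
    by split; [exists (u 0%N); exists 0%N|exists (v 0%N) => _ [k _ <-]].
  by apply: sup_le_ub => [|_ [k _ <-]//]; exists (u 0%N); exists 0%N.
have [p pP] := supP _ _ (fun m n => (cross m n).1).
have [q qP] := supP _ _ (fun m n => (cross m n).2).
have [e e0 eP] := Plocal (pP 0%N) (qP 0%N).
have [n nP1] : exists n, (x2 - x1 + (y2 - y1)) / 2 ^+ n < e.
  have W0 : 0 <= (x2 - x1 + (y2 - y1)) / e.
    by apply: divr_ge0; [rewrite addr_ge0// subr_ge0 ltW|exact: ltW].
  exists (Num.bound ((x2 - x1 + (y2 - y1)) / e)).
  rewrite ltr_pdivrMr ?exprn_gt0// -ltr_pdivrMl// mulrC.
  apply: lt_trans (archi_boundP W0) _.
  by rewrite -natrX ltr_nat ltn_expl.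
have [sr] := badS n; apply; apply: eP => //.
- have [-> _] := width n; apply: le_lt_trans nP1.
  by rewrite ler_pM2r ?invr_gt0 ?exprn_gt0// lerDl subr_ge0 ltW.
- have [_ ->] := width n; apply: le_lt_trans nP1.
  by rewrite ler_pM2r ?invr_gt0 ?exprn_gt0// lerDr subr_ge0 ltW.
Qed.

End bisection.

(** * Linearity and splitting of boundary integrals *)

Section boundary_theory.
Context {R : realType}.
Implicit Types (f g : R[i] -> R[i]) (z w c : R[i]) (x y t : R).

Lemma boundary_sides f x1 x2 y1 y2 : x1 <= x2 -> y1 <= y2 ->
  (forall z, on_boundary x1 x2 y1 y2 z -> cdiff f z) ->
  [/\ cintegrable (fun x => f (x +i* y1)) x1 x2,
      cintegrable (fun x => f (x +i* y2)) x1 x2,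
      cintegrable (fun y => f (x1 +i* y)) y1 y2 &
      cintegrable (fun y => f (x2 +i* y)) y1 y2].
Proof.
move=> x12 y12 df; split.
- apply: horizontal_integrable => x xx; apply: df.
  by split=> //=; [rewrite lexx y12|apply: Or43].
- apply: horizontal_integrable => x xx; apply: df.
  by split=> //=; [rewrite lexx y12|apply: Or44].
- apply: vertical_integrable => x xx; apply: df.
  by split=> //=; [rewrite lexx x12|apply: Or41].
- apply: vertical_integrable => x xx; apply: df.
  by split=> //=; [rewrite lexx x12|apply: Or42].
Qed.

Lemma eq_boundary f g x1 x2 y1 y2 : x1 <= x2 -> y1 <= y2 ->
  (forall z, on_boundary x1 x2 y1 y2 z -> f z = g z) ->
  boundary f x1 x2 y1 y2 = boundary g x1 x2 y1 y2.
Proof.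
move=> x12 y12 fg; rewrite /boundary /horizontal /vertical.
congr (_ + _ * _ - _ - _ * _); apply: eq_cint => t tt; apply: fg; split=> //=.
- by rewrite lexx y12.
- exact: Or43.
- by rewrite lexx x12.
- exact: Or42.
- by rewrite lexx y12.
- exact: Or44.
- by rewrite lexx x12.
- exact: Or41.
Qed.

Lemma boundaryD f g x1 x2 y1 y2 : x1 <= x2 -> y1 <= y2 ->
  (forall z, on_boundary x1 x2 y1 y2 z -> cdiff f z) ->
  (forall z, on_boundary x1 x2 y1 y2 z -> cdiff g z) ->
  boundary (fun z => f z + g z) x1 x2 y1 y2 =
  boundary f x1 x2 y1 y2 + boundary g x1 x2 y1 y2.
Proof.
move=> x12 y12 df dg; rewrite /boundary /horizontal /vertical.
have [f1 f2 f3 f4] := boundary_sides x12 y12 df.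
have [g1 g2 g3 g4] := boundary_sides x12 y12 dg.
by rewrite !cintD//; ring.
Qed.

Lemma boundaryMl c f x1 x2 y1 y2 : x1 <= x2 -> y1 <= y2 ->
  (forall z, on_boundary x1 x2 y1 y2 z -> cdiff f z) ->
  boundary (fun z => c * f z) x1 x2 y1 y2 = c * boundary f x1 x2 y1 y2.
Proof.
move=> x12 y12 df; rewrite /boundary /horizontal /vertical.
have [f1 f2 f3 f4] := boundary_sides x12 y12 df.
by rewrite !cintMl//; ring.
Qed.

Lemma boundaryB f g x1 x2 y1 y2 : x1 <= x2 -> y1 <= y2 ->
  (forall z, on_boundary x1 x2 y1 y2 z -> cdiff f z) ->
  (forall z, on_boundary x1 x2 y1 y2 z -> cdiff g z) ->
  boundary (fun z => f z - g z) x1 x2 y1 y2 =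
  boundary f x1 x2 y1 y2 - boundary g x1 x2 y1 y2.
Proof.
move=> x12 y12 df dg; rewrite /boundary /horizontal /vertical.
have [f1 f2 f3 f4] := boundary_sides x12 y12 df.
have [g1 g2 g3 g4] := boundary_sides x12 y12 dg.
by rewrite !cintB//; ring.
Qed.

Lemma normc_boundary f x1 x2 y1 y2 :
  normc (boundary f x1 x2 y1 y2) <=
  normc (horizontal f x1 x2 y1) + normc (vertical f x2 y1 y2) +
  normc (horizontal f x1 x2 y2) + normc (vertical f x1 y1 y2).
Proof.
rewrite /boundary.
apply: le_trans (ler_normcB _ _) _; rewrite normcM normc_i mul1r lerD2r.
apply: le_trans (ler_normcB _ _) _; rewrite lerD2r.
by apply: le_trans (le_normcD _ _) _; rewrite normcM normc_i mul1r.
Qed.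

Lemma boundary_le f x1 x2 y1 y2 (M : R) : x1 <= x2 -> y1 <= y2 ->
  (forall z, on_boundary x1 x2 y1 y2 z -> cdiff f z) ->
  (forall z, on_boundary x1 x2 y1 y2 z -> normc (f z) <= M) ->
  normc (boundary f x1 x2 y1 y2) <= 4 * M * ((x2 - x1) + (y2 - y1)).
Proof.
move=> x12 y12 df fM.
have [f1 f2 f3 f4] := boundary_sides x12 y12 df.
apply: le_trans (normc_boundary _ _ _ _ _) _.
have h1 : normc (horizontal f x1 x2 y1) <= 2 * M * (x2 - x1).
  apply: cint_le => // t tt; apply: fM; split => //=; last exact: Or43.
  by rewrite lexx y12.
have h2 : normc (horizontal f x1 x2 y2) <= 2 * M * (x2 - x1).
  apply: cint_le => // t tt; apply: fM; split => //=; last exact: Or44.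
  by rewrite lexx y12.
have h3 : normc (vertical f x1 y1 y2) <= 2 * M * (y2 - y1).
  apply: cint_le => // t tt; apply: fM; split => //=; last exact: Or41.
  by rewrite lexx x12.
have h4 : normc (vertical f x2 y1 y2) <= 2 * M * (y2 - y1).
  apply: cint_le => // t tt; apply: fM; split => //=; last exact: Or42.
  by rewrite lexx x12.
apply: le_trans (lerD (lerD (lerD h1 h4) h2) h3) _.
by rewrite le_eqVlt; apply/orP; left; apply/eqP; ring.
Qed.

Lemma boundary_vsplit f x1 m x2 y1 y2 : x1 <= m <= x2 ->
  (forall x, x1 <= x <= x2 -> cdiff f (x +i* y1) /\ cdiff f (x +i* y2)) ->
  boundary f x1 x2 y1 y2 = boundary f x1 m y1 y2 + boundary f m x2 y1 y2.
Proof.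
move=> mm df; rewrite /boundary /horizontal.
rewrite (cint_split mm (horizontal_integrable (fun x xx => (df x xx).1))).
rewrite (cint_split mm (horizontal_integrable (fun x xx => (df x xx).2))).
ring.
Qed.

Lemma boundary_hsplit f x1 x2 y1 m y2 : y1 <= m <= y2 ->
  (forall y, y1 <= y <= y2 -> cdiff f (x1 +i* y) /\ cdiff f (x2 +i* y)) ->
  boundary f x1 x2 y1 y2 = boundary f x1 x2 y1 m + boundary f x1 x2 m y2.
Proof.
move=> mm df; rewrite /boundary /vertical.
rewrite (cint_split mm (vertical_integrable (fun x xx => (df x xx).1))).
rewrite (cint_split mm (vertical_integrable (fun x xx => (df x xx).2))).
ring.
Qed.

Lemma cint_affine (p q : R[i]) a b : a < b ->
  cint (fun t => p + q * t%:C) a b =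
  p * (b - a)%:C + q * ((b ^+ 2 - a ^+ 2) / 2)%:C.
Proof.
move=> ab.
have c1 : cintegrable (fun=> 1 : R[i]) a b.
  apply: cont_cintegrable => t _ e e0; exists 1 => // s _.
  by rewrite subrr normc0.
have ct : cintegrable (fun t => t%:C) a b.
  apply: cont_cintegrable => t _ e e0; exists e => // s.
  by rewrite complexB subrr normc_real.
have cp : cintegrable (fun t : R => p * 1) a b.
  apply: (@horizontal_integrable _ (fun=> p * 1) a b 0) => x _.
  exact: cdiff_cst.
have cq : cintegrable (fun t : R => q * t%:C) a b.
  apply: (@horizontal_integrable _ (fun z => q * z) a b 0) => x _.
  by apply: cdiffM; [exact: cdiff_cst|exact: cdiff_id].
rewrite -[in LHS](mulr1 p).
rewrite cintD// (cintMl p c1) (cintMl q ct).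
congr (_ * _ + _ * _).
- rewrite (@cint_FTC _ (cst 1) (cst 0) id (cst 0))// ?subrr//.
  + by move=> ?; exact: cvg_cst.
  + by move=> ?; exact: cvg_cst.
- have dU t : is_derive t 1 (2^-1 *: (@id R ^+ 2)) (id t).
    apply: is_derive_eq; rewrite expr1 -[_ *: 1]/(_ * _) -[_ *: (_ * _)]/(_ * _).
    by rewrite mulr1 -mulr_natl mulrA mulVf// mul1r.
  have dV t : is_derive t 1 (cst 0 : R -> R) (cst 0 t) by exact: is_derive_cst.
  have ci : continuous (@id R) by move=> ?; exact: cvg_id.
  have c0 : continuous (cst 0 : R -> R) by move=> ?; exact: cvg_cst.
  rewrite [LHS](cint_FTC ab dU dV ci c0).
  rewrite subrr; congr (_ +i* _).
  by rewrite -scalerBr -[_ *: _]/(_ * _) mulrC.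
Qed.

(** Affine functions have primitives; this is the only case that Goursat's
    argument uses. *)
Lemma boundary_affine (p q : R[i]) x1 x2 y1 y2 : x1 < x2 -> y1 < y2 ->
  boundary (fun z => p + q * z) x1 x2 y1 y2 = 0.
Proof.
move=> x12 y12; rewrite /boundary /horizontal /vertical.
have H y a b : a < b -> cint (fun x => p + q * (x +i* y)) a b =
   (p + q * (y%:C * 'i)) * (b - a)%:C + q * ((b ^+ 2 - a ^+ 2) / 2)%:C.
  move=> ab; rewrite -cint_affine//; apply: eq_cint => t _.
  rewrite -addrA -mulrDr; congr (_ + _ * _).
  by rewrite /= complexM complexD; congr (_ +i* _); ring.
have V x a b : a < b -> cint (fun y => p + q * (x +i* y)) a b =
   (p + q * x%:C) * (b - a)%:C + (q * 'i) * ((b ^+ 2 - a ^+ 2) / 2)%:C.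
  move=> ab; rewrite -cint_affine//; apply: eq_cint => t _.
  rewrite -addrA -mulrA -mulrDr; congr (_ + _ * _).
  by rewrite complexM complexD; congr (_ +i* _); ring.
rewrite !H// !V//.
rewrite !rmorphB !rmorphM !rmorphB !rmorphXn /=.
have i2 : 'i * 'i = -1 :> R[i] by rewrite complexM; congr (_ +i* _); ring.
ring: i2.
Qed.

End boundary_theory.

(** * Goursat's theorem *)

Section goursat.
Context {R : realType}.
Implicit Types (f g : R[i] -> R[i]) (z w : R[i]) (x y t a b c d : R).

(** The inner sides cancel in pairs. *)
Lemma boundary_quarter f a m b c n d : a <= m <= b -> c <= n <= d ->
  (forall z, in_rectangle a b c d z -> cdiff f z) ->
  boundary f a b c d =
    boundary f a m c n + boundary f m b c n +
    (boundary f a m n d + boundary f m b n d).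
Proof.
move=> /andP[am mb] /andP[cn nd] df.
have cd := le_trans cn nd; have ab := le_trans am mb.
rewrite (@boundary_hsplit _ _ _ _ _ n) ?cn//; last first.
  by move=> y yy; split; apply: df; split => //=; rewrite lexx ab.
congr (_ + _); apply: boundary_vsplit; rewrite ?am ?mb//;
  move=> x xx; split; apply: df; split => //=.
- by rewrite lexx.
- by rewrite cn.
- by rewrite cn.
- by rewrite lexx cd.
Qed.

Lemma normc_in_rectangle a b c d (z w : R[i]) :
  in_rectangle a b c d z -> in_rectangle a b c d w ->
  normc (z - w) <= (b - a) + (d - c).
Proof.
move=> zin win; apply: le_trans (normc_le_ReIm _) _; move: zin win.
case: z w => [z1 z2] [w1 w2] [/= /andP[? ?] /andP[? ?]] [/= /andP[? ?] /andP[? ?]].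
by apply: lerD; rewrite ler_norml; apply/andP; split; lra.
Qed.

Lemma on_boundary_in a b c d z : on_boundary a b c d z -> in_rectangle a b c d z.
Proof. by case. Qed.

(** The property that survives quartering is that the boundary integral is at
    most [e] times the squared half perimeter: quartering halves the perimeter,
    so that the four bounds add up to the bound of the whole. Near a point,
    [f] is an affine function, whose integral vanishes, plus a remainder of at
    most [e/4] times the distance, integrated over a boundary of comparable
    length. *)
Lemma goursat f x1 x2 y1 y2 : x1 < x2 -> y1 < y2 ->
  (forall z, in_rectangle x1 x2 y1 y2 z -> cdiff f z) ->
  boundary f x1 x2 y1 y2 = 0.
Proof.
move=> x12 y12 df; apply/eqP; rewrite -normc_eq0; apply/eqP.
apply/le_anti; rewrite normc_ge0 andbT.
apply/ler_addgt0Pr => e0 e0_gt0; rewrite add0r.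
pose e := e0 / ((x2 - x1) + (y2 - y1)) ^+ 2.
have L0 : 0 < (x2 - x1) + (y2 - y1) by rewrite addr_gt0// subr_gt0.
have e_gt0 : 0 < e by rewrite divr_gt0// exprn_gt0.
suff: normc (boundary f x1 x2 y1 y2) <= e * ((x2 - x1) + (y2 - y1)) ^+ 2.
  by rewrite /e divfK// expf_neq0// gt_eqF.
pose P a b c d := normc (boundary f a b c d) <= e * ((b - a) + (d - c)) ^+ 2.
have subD a b c d : subrectangle x1 x2 y1 y2 a b c d ->
    forall z, in_rectangle a b c d z -> cdiff f z.
  move=> [h1 h2 h3 [h4 h5 h6]] z [/andP[z1 z2] /andP[z3 z4]]; apply: df.
  by split; apply/andP; split; lra.
apply: (@bisection _ P) => //; rewrite /P.
- move=> a b c d S P1 P2 P3 P4; have [_ ab _ [_ cd _]] := S.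
  rewrite (@boundary_quarter f a ((a + b) / 2) b c ((c + d) / 2) d).
  + apply: le_trans (le_normcD _ _) _.
    apply: le_trans (lerD (le_normcD _ _) (le_normcD _ _)) _.
    apply: le_trans (lerD (lerD P1 P2) (lerD P3 P4)) _.
    by rewrite le_eqVlt; apply/orP; left; apply/eqP; field.
  + by rewrite !midf_le ?(ltW ab).
  + by rewrite !midf_le ?(ltW cd).
  + exact: subD S.
- move=> p q pp qq.
  have e40 : 0 < e / 4 by rewrite divr_gt0.
  have dfp : cdiff f (p +i* q) by apply: df.
  have [d d0 dP] := cdiff_normcP dfp e40.
  exists (d / 2) => [|a b c c' S ap cq bad cd]; first by rewrite divr_gt0.
  have [_ ab _ [_ cc _]] := S.
  (* k + l z is the tangent of f at the point. *)
  pose l := cderiv 1 f (p +i* q); pose k := f (p +i* q) - l * (p +i* q).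
  have pin : in_rectangle a b c c' (p +i* q) by [].
  have dk z : cdiff (fun w => k + l * w) z.
    apply: cdiffD; first exact: cdiff_cst.
    by apply: cdiffM; [exact: cdiff_cst|exact: cdiff_id].
  have -> : boundary f a b c c' = boundary (fun z => f z - (k + l * z)) a b c c'.
    have dfb z : on_boundary a b c c' z -> cdiff f z.
      by move=> /on_boundary_in; exact: subD S z.
    rewrite (boundaryB (ltW ab) (ltW cc) dfb (fun z _ => dk z)).
    by rewrite boundary_affine// subr0.
  apply: (@le_trans _ _ 
    (4 * (e / 4 * ((b - a) + (c' - c))) * ((b - a) + (c' - c)))); last first.
    by rewrite le_eqVlt; apply/orP; left; apply/eqP; field.
  apply: boundary_le; [exact: ltW|exact: ltW| |].
  + by move=> z /on_boundary_in zin; apply: cdiffB; [exact: subD S _ zin|exact: dk].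
  + move=> z /on_boundary_in zin.
    have zp := normc_in_rectangle zin pin.
    rewrite (_ : _ - _ = f z - f (p +i* q) - l * (z - (p +i* q))); last first.
      by rewrite /k; ring.
    apply: le_trans (dP _ _) _; last by rewrite ler_pM2l.
    by apply: le_lt_trans zp _; lra.
Qed.

(** Two vertical strips, and the parts of the middle strip above and below the
    square, avoid the singular point; their boundary integrals vanish. *)
Lemma boundary_shrink f (p q r : R) x1 x2 y1 y2 :
  0 < r -> x1 < p - r -> p + r < x2 -> y1 < q - r -> q + r < y2 ->
  (forall z, in_rectangle x1 x2 y1 y2 z -> z != p +i* q -> cdiff f z) ->
  boundary f x1 x2 y1 y2 = boundary f (p - r) (p + r) (q - r) (q + r).
Proof.
move=> r0 h1 h2 h3 h4 df.
have dx x y : x1 <= x <= x2 -> y1 <= y <= y2 -> x < p \/ p < x -> cdiff f (x +i* y).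
  move=> xx yy xp; apply: df => //; apply/eqP => -[xp'] _.
  by move: xp; rewrite xp' => -[]; rewrite ltxx.
have dy x y : x1 <= x <= x2 -> y1 <= y <= y2 -> y < q \/ q < y -> cdiff f (x +i* y).
  move=> xx yy xp; apply: df => //; apply/eqP => -[_] xp'.
  by move: xp; rewrite xp' => -[]; rewrite ltxx.
rewrite (@boundary_vsplit _ f x1 (p - r) x2); last 2 first.
- by apply/andP; split; lra.
- by move=> x /andP[? ?]; split; apply: dy;
    [apply/andP; lra|apply/andP; lra|left; lra|
     apply/andP; lra|apply/andP; lra|right; lra].
rewrite (@boundary_vsplit _ f (p - r) (p + r) x2); last 2 first.
- by apply/andP; split; lra.
- by move=> x /andP[? ?]; split; apply: dy;
    [apply/andP; lra|apply/andP; lra|left; lra|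
     apply/andP; lra|apply/andP; lra|right; lra].
rewrite (@boundary_hsplit _ f (p - r) (p + r) y1 (q - r) y2); last 2 first.
- by apply/andP; split; lra.
- by move=> x /andP[? ?]; split; apply: dx;
    [apply/andP; lra|apply/andP; lra|left; lra|
     apply/andP; lra|apply/andP; lra|right; lra].
rewrite (@boundary_hsplit _ f (p - r) (p + r) (q - r) (q + r) y2); last 2 first.
- by apply/andP; split; lra.
- by move=> x /andP[? ?]; split; apply: dx;
    [apply/andP; lra|apply/andP; lra|left; lra|
     apply/andP; lra|apply/andP; lra|right; lra].
rewrite (@goursat f x1 (p - r) y1 y2); [|lra|lra|]; last first.
  by move=> [x y] [/= /andP[? ?] /andP[? ?]];
    apply: dx; [apply/andP; lra|apply/andP; lra|left; lra].
rewrite (@goursat f (p + r) x2 y1 y2); [|lra|lra|]; last first.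
  by move=> [x y] [/= /andP[? ?] /andP[? ?]];
    apply: dx; [apply/andP; lra|apply/andP; lra|right; lra].
rewrite (@goursat f (p - r) (p + r) y1 (q - r)); [|lra|lra|]; last first.
  by move=> [x y] [/= /andP[? ?] /andP[? ?]];
    apply: dy; [apply/andP; lra|apply/andP; lra|left; lra].
rewrite (@goursat f (p - r) (p + r) (q + r) y2); [|lra|lra|]; last first.
  by move=> [x y] [/= /andP[? ?] /andP[? ?]];
    apply: dy; [apply/andP; lra|apply/andP; lra|right; lra].
ring.
Qed.

End goursat.

(** * The winding number of a square *)

Section cauchy.
Context {R : realType}.
Implicit Types (f g : R[i] -> R[i]) (z w : R[i]) (x y t a b c d : R).

Lemma cdiff_subV (w z : R[i]) : z != w -> cdiff (fun u => (u - w)^-1) z.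
Proof.
move=> zw; apply: cdiffV; first by rewrite subr_eq0.
by apply: cdiffB; [exact: cdiff_id|exact: cdiff_cst].
Qed.

Lemma on_square_neq (p q r : R) z : 0 < r ->
  on_boundary (p - r) (p + r) (q - r) (q + r) z -> z != p +i* q.
Proof.
move=> r0; case: z => x y [/= _ _ H]; apply/eqP => -[xp yq].
by case: H; rewrite ?xp ?yq; lra.
Qed.

(** On opposite sides of a square the values of [1/(z-a)] combine to this
    function, up to a factor [i]. *)
Lemma is_derive_atan_affine (p r t : R) : 0 < r ->
  is_derive t 1 (fun s => 2 * atan ((s - p) / r)) (2 * r / ((t - p) ^+ 2 + r ^+ 2)).
Proof.
move=> r0.
have H : is_derive t 1 (fun s => (s - p) / r) r^-1.
  have -> : (fun s => (s - p) / r) = r^-1 *: (@id R - cst p).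
    by apply/funext => s; rewrite /= mulrC.
  by apply: is_derive_eq; rewrite subr0 -[_ *: 1]/(_ * _) mulr1.
have H2 := @is_derive1_comp R atan (fun s => (s - p) / r) t _ _
  (is_derive1_atan ((t - p) / r)) H.
have -> : (fun s => 2 * atan ((s - p) / r)) =
    2 *: (atan \o (fun s => (s - p) / r)) by [].
apply: is_derive_eq; rewrite -[_ *: _]/(_ * _).
have : 0 <= ((t - p) / r) ^+ 2 by exact: sqr_ge0.
have : 0 <= (t - p) ^+ 2 by exact: sqr_ge0.
have : 0 < r ^+ 2 by rewrite exprn_gt0.
move=> h1 h2 h3; field.
by rewrite !gt_eqF//; lra.
Qed.

Lemma continuous_atan_affine_derive (p r : R) : 0 < r ->
  continuous (fun t => 2 * r / ((t - p) ^+ 2 + r ^+ 2)).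
Proof.
move=> r0 t; apply: cvgM; first exact: cvg_cst.
apply: cvgV.
  by rewrite gt_eqF// ltr_wpDl ?sqr_ge0 ?exprn_gt0.
apply: cvgD; last exact: cvg_cst.
apply: (@cvg_comp _ _ _ (fun t => t - p) (fun t => t ^+ 2)); last first.
  exact: exprn_continuous.
by apply: cvgB; [exact: cvg_id|exact: cvg_cst].
Qed.

(** The logarithmic parts cancel between opposite sides, and each pair of sides
    contributes [pi * i] through the arctangent. *)
Lemma boundary_square_inv (p q r : R) : 0 < r ->
  boundary (fun z => (z - (p +i* q))^-1) (p - r) (p + r) (q - r) (q + r) =
  (2 * pi)%:C * 'i.
Proof.
move=> r0.
have pq : p - r < p + r by lra.
have qr : q - r < q + r by lra.
have [h1 h2 v1 v2] := boundary_sides (ltW pq) (ltW qr)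
  (fun z zb => cdiff_subV (on_square_neq r0 zb)).
rewrite /boundary /horizontal /vertical.
rewrite [X in X - _](_ : _ =
   (cint (fun x => (x +i* (q - r) - p +i* q)^-1) (p - r) (p + r) -
    cint (fun x => (x +i* (q + r) - p +i* q)^-1) (p - r) (p + r)) +
   'i * (cint (fun y => ((p + r) +i* y - p +i* q)^-1) (q - r) (q + r)));
  last by ring.
rewrite -addrA -mulrBr -(cintB h1 h2) -(cintB v2 v1).
have atanr : atan (r / r) = pi / 4 :> R by rewrite divff ?gt_eqF// atan1.
have atanNr : atan (- r / r) = - (pi / 4) :> R.
  by rewrite mulNr divff ?gt_eqF// atanN atan1.
have E x y : (x +i* y) - (p +i* q) = (x - p) +i* (y - q) by [].
have q1 : q - r - q = - r by ring.
have q2 : q + r - q = r by ring.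
have p1 : p - r - p = - r by ring.
have p2 : p + r - p = r by ring.
have c0 : continuous (cst 0 : R -> R) by move=> ?; exact: cvg_cst.
have d0 t : is_derive t 1 (cst 0 : R -> R) (cst 0 t) by exact: is_derive_cst.
rewrite (eq_cint (psi := fun t =>
  cst 0 t +i* (2 * r / ((t - p) ^+ 2 + r ^+ 2)))); last first.
  move=> t _; rewrite !E !invc_def complexB.
  rewrite q1 q2.
  rewrite sqrrN subrr; congr (_ +i* _).
  by rewrite mulNr opprK -mulrDl mulr_natl mulr2n.
rewrite (cint_FTC pq d0 (fun t => is_derive_atan_affine p t r0) c0
  (@continuous_atan_affine_derive p r r0)).
rewrite (eq_cint (psi := fun t =>
  (2 * r / ((t - q) ^+ 2 + r ^+ 2)) +i* cst 0 t)); last first.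
  move=> t _; rewrite !E !invc_def complexB.
  rewrite p1 p2.
  rewrite sqrrN [r ^+ 2 + _]addrC subrr; congr (_ +i* _).
  by rewrite mulNr opprK -mulrDl mulr_natl mulr2n.
rewrite (cint_FTC qr (fun t => is_derive_atan_affine q t r0) d0
  (@continuous_atan_affine_derive q r r0) c0).
rewrite p1 p2 q1 q2.
rewrite atanr atanNr /cst subrr.
have -> : 2 * (pi / 4) - 2 * - (pi / 4) = pi :> R by lra.
by rewrite !complexM complexD; congr (_ +i* _); ring.
Qed.

End cauchy.

(** * Cauchy's formula *)

Section cauchy_formula.
Context {R : realType}.
Implicit Types (f g : R[i] -> R[i]) (z w : R[i]) (x y t a b c d : R).

Lemma on_boundary_neq x1 x2 y1 y2 (p q : R) z : x1 < p < x2 -> y1 < q < y2 ->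
  on_boundary x1 x2 y1 y2 z -> z != p +i* q.
Proof.
move=> /andP[p1 p2] /andP[q1 q2]; case: z => x y [/= _ _ H].
by apply/eqP => -[xp yq]; case: H; rewrite ?xp ?yq; lra.
Qed.

(** The extra bound [e] lets the square also fit in a given neighbourhood of the
    point. *)
Lemma small_radius x1 x2 y1 y2 p q (e : R) : x1 < p < x2 -> y1 < q < y2 -> 0 < e ->
  exists r : R, [/\ 0 < r, r < e, x1 < p - r /\ p + r < x2 &
    y1 < q - r /\ q + r < y2].
Proof.
move=> /andP[p1 p2] /andP[q1 q2] e0.
pose m := Num.min e
  (Num.min (Num.min (p - x1) (x2 - p)) (Num.min (q - y1) (y2 - q))).
have m0 : 0 < m by rewrite !lt_min !subr_gt0 p1 p2 q1 q2 e0.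
have [r0 rm] : 0 < m / 2 /\ m / 2 < m by split; lra.
exists (m / 2); move: rm; rewrite {2}/m !lt_min.
move=> /andP[h1 /andP[/andP[h2 h3] /andP[h4 h5]]].
by split => //; split; lra.
Qed.

(** The integral equals the one over an arbitrarily small square, which is at most
    the perimeter times the bound. *)
Lemma boundary_bounded_singularity f (p q M d : R) x1 x2 y1 y2 :
  x1 < p < x2 -> y1 < q < y2 -> 0 < d ->
  (forall z, in_rectangle x1 x2 y1 y2 z -> z != p +i* q -> cdiff f z) ->
  (forall z, normc (z - (p +i* q)) < d -> normc (f z) <= M) ->
  boundary f x1 x2 y1 y2 = 0.
Proof.
move=> pp qq d0 df fM.
apply/eqP; rewrite -normc_eq0; apply/eqP; apply/le_anti; rewrite normc_ge0 andbT.
apply/ler_addgt0Pr => e e0; rewrite add0r.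
have M0 : 0 <= M.
  by apply: le_trans (fM (p +i* q) _); rewrite ?normc_ge0// subrr normc0.
have e10 : 0 < Num.min (d / 2) (e / (16 * (M + 1))).
  by rewrite lt_min !divr_gt0// mulr_gt0// ltr_wpDl.
have [r [r0 re [p1 p2] [q1 q2]]] := small_radius pp qq e10.
rewrite (boundary_shrink r0 p1 p2 q1 q2 df).
move: re; rewrite lt_min => /andP[rd re].
have [pr qr] : p - r < p + r /\ q - r < q + r by split; lra.
have K z : on_boundary (p - r) (p + r) (q - r) (q + r) z ->
    normc (z - (p +i* q)) < d.
  move=> zb; apply: le_lt_trans (normc_le_ReIm _) _.
  case: z zb => x y [/= /andP[? ?] /andP[? ?] _].
  suff: `|x - p| <= r /\ `|y - q| <= r by move=> [? ?] /=; lra.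
  by rewrite !ler_norml; split; apply/andP; split; lra.
apply: le_trans (@boundary_le R f _ _ _ _ M (ltW pr) (ltW qr) _ _) _.
- move=> z zb; apply: df; last exact: on_square_neq zb.
  case: z zb => x y [/= /andP[? ?] /andP[? ?] _].
  by split; apply/andP; split => /=; lra.
- by move=> z /K; exact: fM.
- have -> : 4 * M * (p + r - (p - r) + (q + r - (q - r))) = 16 * M * r by ring.
  move: re; rewrite ltr_pdivlMr; last by rewrite mulr_gt0// ltr_wpDl.
  by nra.
Qed.

Lemma boundary_inv (p q : R) x1 x2 y1 y2 : x1 < p < x2 -> y1 < q < y2 ->
  boundary (fun z => (z - (p +i* q))^-1) x1 x2 y1 y2 = (2 * pi)%:C * 'i.
Proof.
move=> pp qq.
have [r [r0 _ [p1 p2] [q1 q2]]] := small_radius pp qq (@ltr01 R).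
rewrite (boundary_shrink r0 p1 p2 q1 q2); last by move=> z _; exact: cdiff_subV.
exact: boundary_square_inv.
Qed.

(** [(f z - f a) / (z - a)] is bounded near [a] because [f] is differentiable
    there, so that only [f a / (z - a)] contributes. *)
Lemma cauchy_formula f (p q : R) x1 x2 y1 y2 : x1 < p < x2 -> y1 < q < y2 ->
  (forall z, in_rectangle x1 x2 y1 y2 z -> cdiff f z) ->
  boundary (fun z => f z * (z - (p +i* q))^-1) x1 x2 y1 y2 =
  (2 * pi)%:C * 'i * f (p +i* q).
Proof.
move=> pp qq df.
have [/andP[p1 p2] /andP[q1 q2]] := (pp, qq).
have x12 := ltW (lt_trans p1 p2); have y12 := ltW (lt_trans q1 q2).
set a := p +i* q.
have dV z : on_boundary x1 x2 y1 y2 z -> cdiff (fun u => (u - a)^-1) z.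
  by move=> /(on_boundary_neq pp qq); exact: cdiff_subV.
have dQ z : in_rectangle x1 x2 y1 y2 z -> z != a ->
    cdiff (fun u => (f u - f a) * (u - a)^-1) z.
  move=> zin za; apply: cdiffM; last exact: cdiff_subV.
  by apply: cdiffB; [exact: df|exact: cdiff_cst].
rewrite (eq_boundary (g := fun z => (f z - f a) * (z - a)^-1 +
  f a * (z - a)^-1) x12 y12); last first.
  by move=> z _; ring.
have dQb z : on_boundary x1 x2 y1 y2 z ->
    cdiff (fun u => (f u - f a) * (u - a)^-1) z.
  by move=> zb; apply: dQ; [exact: on_boundary_in|exact: on_boundary_neq zb].
have dCb z : on_boundary x1 x2 y1 y2 z -> cdiff (fun u => f a * (u - a)^-1) z.
  by move=> zb; apply: cdiffM; [exact: cdiff_cst|exact: dV].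
rewrite (boundaryD x12 y12 dQb dCb) (boundaryMl (f a) x12 y12 dV).
rewrite (boundary_inv pp qq).
have ain : in_rectangle x1 x2 y1 y2 a by split => /=; apply/andP; split; exact: ltW.
have [d d0 dP] := cdiff_normcP (df _ ain) (@ltr01 R).
rewrite (@boundary_bounded_singularity _ p q (normc (cderiv 1 f a) + 1) d
  _ _ _ _ pp qq d0 dQ).
  by rewrite add0r mulrC.
move=> z zd; rewrite -/a; have [->|za] := eqVneq z a.
    by rewrite subrr mul0r normc0 addr_ge0// normc_ge0.
  have za0 : 0 < normc (z - a) by rewrite normc_gt0 subr_eq0.
  rewrite normcM normcV ler_pdivrMr// mulrDl -normcM [leRHS]addrC.
  have -> : f z - f a = (f z - f a - cderiv 1 f a * (z - a)) +
      cderiv 1 f a * (z - a) by ring.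
  by apply: le_trans (le_normcD _ _) _; rewrite lerD2r; exact: dP.
Qed.

End cauchy_formula.

(** * Estimates of powers of the Cauchy kernel *)

Section cauchy_derivatives.
Context {R : realType}.
Implicit Types (f g : R[i] -> R[i]) (z w : R[i]) (x y t a b c d : R).

(** Compactness, obtained from [bisection] with boundedness as the property. *)
Lemma rectangle_bounded g x1 x2 y1 y2 : x1 < x2 -> y1 < y2 ->
  (forall z, in_rectangle x1 x2 y1 y2 z -> cdiff g z) ->
  exists2 M : R, 0 < M & forall z, in_rectangle x1 x2 y1 y2 z -> normc (g z) <= M.
Proof.
move=> x12 y12 dg.
pose P a b c d := exists2 M : R, 0 < M &
  forall z, in_rectangle a b c d z -> normc (g z) <= M.
apply: (@bisection _ P) => //.
- move=> a b c d _ [M1 M10 H1] [M2 M20 H2] [M3 M30 H3] [M4 M40 H4].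
  exists (M1 + M2 + (M3 + M4)); first by rewrite !addr_gt0.
  move=> [x y] [/= /andP[ax xb] /andP[cy yd]].
  have [xm|mx] := leP x ((a + b) / 2); have [ym|my] := leP y ((c + d) / 2).
  + by apply: le_trans (H1 _ _) _; [split => /=; apply/andP; split; lra|lra].
  + by apply: le_trans (H3 _ _) _; [split => /=; apply/andP; split; lra|lra].
  + by apply: le_trans (H2 _ _) _; [split => /=; apply/andP; split; lra|lra].
  + by apply: le_trans (H4 _ _) _; [split => /=; apply/andP; split; lra|lra].
- move=> p q pp qq.
  have dgp : cdiff g (p +i* q) by apply: dg.
  have [d d0 dP] := cdiff_cont dgp (@ltr01 R).
  exists (d / 2); first by rewrite divr_gt0.
  move=> a b c c' _ ap cq ba cc; exists (normc (g (p +i* q)) + 1).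
    by rewrite ltr_wpDl// normc_ge0.
  move=> z zin; rewrite -[g z](subrK (g (p +i* q))) addrC.
  apply: le_trans (le_normcD _ _) _; rewrite lerD2l; apply/ltW/dP.
  have pin : in_rectangle a b c c' (p +i* q) by [].
  by apply: le_lt_trans (normc_in_rectangle zin pin) _; lra.
Qed.

(** With [u = (z-a)^-1], [v = (z-a-h)^-1] the hypothesis holds, and the statement
    is the uniform first-order expansion of [(z-a-h)^-n] in [h] that allows
    differentiation under the integral. *)
Lemma inverse_power_estimate (u v h : R[i]) (B : R) n :
  v - u = h * u * v -> normc u <= B -> normc v <= B ->
  normc (v ^+ n - u ^+ n - n%:R * h * u ^+ n.+1) <=
  n%:R ^+ 2 * normc h ^+ 2 * B ^+ n.+2.
Proof.
move=> vu uB vB; have B0 : 0 <= B by exact: le_trans (normc_ge0 _) uB.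
have h0 := normc_ge0 h.
elim: n => [|n IH].
  by rewrite !expr0 subrr !mul0r subrr normc0 expr0n/= !mul0r.
have -> : v ^+ n.+1 - u ^+ n.+1 - n.+1%:R * h * u ^+ n.+2 =
   v * (v ^+ n - u ^+ n - n%:R * h * u ^+ n.+1) +
   (n%:R * h * u ^+ n.+1 * (h * u * v) + u ^+ n * (h * u * (h * u * v))).
  have huv : h * u * v = v - u by [].
  rewrite !exprS -natr1; ring: huv.
have E1 : normc (v * (v ^+ n - u ^+ n - n%:R * h * u ^+ n.+1)) <=
    B * (n%:R ^+ 2 * normc h ^+ 2 * B ^+ n.+2).
  by rewrite normcM; apply: ler_pM; rewrite ?normc_ge0.
have E2 : normc (n%:R * h * u ^+ n.+1 * (h * u * v)) <=
    n%:R * normc h * B ^+ n.+1 * (normc h * B * B).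
  rewrite !normcM normcX normc_nat.
  apply: ler_pM; rewrite ?mulr_ge0 ?exprn_ge0 ?normc_ge0//.
    apply: ler_pM; rewrite ?mulr_ge0 ?exprn_ge0 ?normc_ge0//.
    by rewrite lerXn2r ?nnegrE ?normc_ge0.
  by do 2 (apply: ler_pM; rewrite ?mulr_ge0 ?normc_ge0//).
have E3 : normc (u ^+ n * (h * u * (h * u * v))) <=
    B ^+ n * (normc h * B * (normc h * B * B)).
  rewrite !normcM normcX.
  apply: ler_pM; rewrite ?mulr_ge0 ?exprn_ge0 ?normc_ge0//.
    by rewrite lerXn2r ?nnegrE ?normc_ge0.
  by do 3 (apply: ler_pM; rewrite ?mulr_ge0 ?normc_ge0//).
apply: le_trans (le_normcD _ _) _.
apply: le_trans (lerD E1 (le_trans (le_normcD _ _) (lerD E2 E3))) _.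
rewrite -subr_ge0 !exprS -natr1.
rewrite [leRHS](_ : _ = n%:R * normc h ^+ 2 * B ^+ n * B ^+ 3); last by ring.
by rewrite !mulr_ge0 ?exprn_ge0.
Qed.

End cauchy_derivatives.

(** * Derivatives as boundary integrals *)

Section derivatives.
Context {R : realType}.
Implicit Types (f g : R[i] -> R[i]) (z w : R[i]) (x y t a b c d : R).

Lemma twopi_ge1 (S : realType) : 1 <= 2 * pi :> S.
Proof. by have := pi_ge2 S; lra. Qed.

Lemma on_boundary_far x1 x2 y1 y2 (p q r : R) z :
  x1 <= p - r -> p + r <= x2 -> y1 <= q - r -> q + r <= y2 ->
  on_boundary x1 x2 y1 y2 z -> r <= normc (z - (p +i* q)).
Proof.
move=> h1 h2 h3 h4 [_ _ H].
have Hre : r <= `|Re z - p| -> r <= normc (z - (p +i* q)).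
  move=> /le_trans; apply; have := normc_Re (z - (p +i* q)).
  by case: z {H} => x y.
have Him : r <= `|Im z - q| -> r <= normc (z - (p +i* q)).
  move=> /le_trans; apply; have := normc_Im (z - (p +i* q)).
  by case: z {H Hre} => x y.
case: H => E; [apply: Hre|apply: Hre|apply: Him|apply: Him]; rewrite E.
- by rewrite distrC; apply: le_trans (ler_norm _); lra.
- by apply: le_trans (ler_norm _); lra.
- by rewrite distrC; apply: le_trans (ler_norm _); lra.
- by apply: le_trans (ler_norm _); lra.
Qed.

Definition cauchy_kernel g x1 x2 y1 y2 k w : R[i] :=
  boundary (fun z => g z * (z - w)^-1 ^+ k.+1) x1 x2 y1 y2.

(** The kernel of the Cauchy integral may be expanded under the integral sign,
    since the boundary keeps a positive distance [r] from [a], hence distance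
    [r / 2] from all nearby points. *)
Lemma cauchy_kernel_expansion g (p q : R) x1 x2 y1 y2 k :
  x1 < p < x2 -> y1 < q < y2 ->
  (forall z, in_rectangle x1 x2 y1 y2 z -> cdiff g z) ->
  forall e : R, 0 < e -> exists2 d : R, 0 < d &
    forall w, normc (w - (p +i* q)) < d ->
    normc (cauchy_kernel g x1 x2 y1 y2 k w - cauchy_kernel g x1 x2 y1 y2 k (p +i* q)
      - k.+1%:R * cauchy_kernel g x1 x2 y1 y2 k.+1 (p +i* q) * (w - (p +i* q)))
    <= e * normc (w - (p +i* q)).
Proof.
move=> pp qq dg e e0.
have [/andP[p1 p2] /andP[q1 q2]] := (pp, qq).
have x12 := lt_trans p1 p2; have y12 := lt_trans q1 q2.
have [M M0 gM] := rectangle_bounded x12 y12 dg.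
have [r [r0 _ [r1 r2] [r3 r4]]] := small_radius pp qq (@ltr01 R).
set a := p +i* q; pose n := k.+1; pose B : R := 2 / r.
(* The remainder of the expansion is at most Q |h|^2. *)
pose Q := 4 * (M * (n%:R ^+ 2 * B ^+ n.+2)) * ((x2 - x1) + (y2 - y1)).
have B0 : 0 < B by rewrite divr_gt0.
have L0 : 0 <= (x2 - x1) + (y2 - y1) by rewrite addr_ge0// subr_ge0 ltW.
have Q0 : 0 <= Q.
  apply: mulr_ge0 => //; apply: mulr_ge0 => //; apply: mulr_ge0; first exact: ltW.
  by apply: mulr_ge0; rewrite exprn_ge0// ltW.
exists (Num.min (r / 2) (e / (Q + 1))).
  by rewrite lt_min !divr_gt0// ltr_wpDl.
move=> w; rewrite lt_min => /andP[wr wQ].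
have far z : on_boundary x1 x2 y1 y2 z -> r <= normc (z - a).
  by apply: on_boundary_far; exact: ltW.
have farw z : on_boundary x1 x2 y1 y2 z -> r / 2 <= normc (z - w).
  move=> /far zr; have := le_normcD (z - w) (w - a).
  by rewrite (_ : z - w + (w - a) = z - a); [lra|ring].
have neqa z : on_boundary x1 x2 y1 y2 z -> z != a.
  by move=> /far zr; rewrite -subr_eq0 -normc_gt0; lra.
have neqw z : on_boundary x1 x2 y1 y2 z -> z != w.
  by move=> /farw zr; rewrite -subr_eq0 -normc_gt0; lra.
have dg' z : on_boundary x1 x2 y1 y2 z -> cdiff g z by move=> /on_boundary_in/dg.
have dK m u : (forall z, on_boundary x1 x2 y1 y2 z -> z != u) ->
    forall z, on_boundary x1 x2 y1 y2 z -> cdiff (fun z => g z * (z - u)^-1 ^+ m) z.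
  move=> H z zb; apply: cdiffM; first exact: dg'.
  by apply: cdiffX; apply: cdiff_subV; exact: H.
pose h := w - a.
pose F1 z := g z * (z - w)^-1 ^+ n; pose F2 z := g z * (z - a)^-1 ^+ n.
pose F3 z := g z * (z - a)^-1 ^+ n.+1.
have dF1 : forall z, on_boundary x1 x2 y1 y2 z -> cdiff F1 z := dK n w neqw.
have dF2 : forall z, on_boundary x1 x2 y1 y2 z -> cdiff F2 z := dK n a neqa.
have dF3 : forall z, on_boundary x1 x2 y1 y2 z -> cdiff F3 z := dK n.+1 a neqa.
have dF12 z : on_boundary x1 x2 y1 y2 z -> cdiff (fun u => F1 u - F2 u) z.
  by move=> zb; apply: cdiffB; [exact: dF1|exact: dF2].
have dF3' z : on_boundary x1 x2 y1 y2 z -> cdiff (fun u => (n%:R * h) * F3 u) z.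
  by move=> zb; apply: cdiffM; [exact: cdiff_cst|exact: dF3].
have -> : cauchy_kernel g x1 x2 y1 y2 k w - cauchy_kernel g x1 x2 y1 y2 k a
      - k.+1%:R * cauchy_kernel g x1 x2 y1 y2 k.+1 a * (w - a) =
   boundary (fun z => (F1 z - F2 z) - (n%:R * h) * F3 z) x1 x2 y1 y2.
  rewrite (boundaryB (ltW x12) (ltW y12) dF12 dF3').
  rewrite (boundaryB (ltW x12) (ltW y12) dF1 dF2).
  rewrite (boundaryMl _ (ltW x12) (ltW y12) dF3).
  rewrite -[cauchy_kernel _ _ _ _ _ k w]/(boundary F1 x1 x2 y1 y2).
  rewrite -[cauchy_kernel _ _ _ _ _ k a]/(boundary F2 x1 x2 y1 y2).
  rewrite -[cauchy_kernel _ _ _ _ _ k.+1 a]/(boundary F3 x1 x2 y1 y2) /h /n.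
  move: (boundary F1 _ _ _ _) (boundary F2 _ _ _ _) (boundary F3 _ _ _ _).
  by move=> *; ring.
have hn := normc_ge0 h.
apply: (@le_trans _ _ (4 * (M * (n%:R ^+ 2 * normc h ^+ 2 * B ^+ n.+2)) *
    ((x2 - x1) + (y2 - y1)))).
  apply: boundary_le; [exact: ltW|exact: ltW| |].
    by move=> z zb; apply: cdiffB; [exact: dF12|exact: dF3'].
  move=> z zb.
  have -> : F1 z - F2 z - n%:R * h * F3 z = g z *
      ((z - w)^-1 ^+ n - (z - a)^-1 ^+ n - n%:R * h * (z - a)^-1 ^+ n.+1).
    by rewrite /F1 /F2 /F3; ring.
  rewrite normcM; apply: ler_pM; rewrite ?normc_ge0//.
    by apply: gM; exact: on_boundary_in.
  have za0 : z - a != 0 by rewrite subr_eq0 neqa.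
  have zw0 : z - w != 0 by rewrite subr_eq0 neqw.
  apply: inverse_power_estimate.
  - by rewrite /h; field; rewrite za0 zw0.
  - rewrite normcV -[B]invrK lef_pV2 ?posrE ?invr_gt0 ?normc_gt0//.
    by rewrite /B invf_div; have := far _ zb; lra.
  - rewrite normcV -[B]invrK lef_pV2 ?posrE ?invr_gt0 ?normc_gt0//.
    by rewrite /B invf_div; exact: farw.
have -> : 4 * (M * (n%:R ^+ 2 * normc h ^+ 2 * B ^+ n.+2)) *
   ((x2 - x1) + (y2 - y1)) = (Q * normc h) * normc h by rewrite /Q; ring.
rewrite ler_wpM2r// -/h; move: wQ; rewrite ltr_pdivlMr; last by rewrite ltr_wpDl.
by rewrite -/h; nra.
Qed.

Lemma cderivS k f : cderiv k.+1 f = cderiv 1 (cderiv k f).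
Proof. by []. Qed.

(** Induction on [k]; the formula at order [k] holds near the point, so it may be
    differentiated there. *)
Lemma cderiv_cauchy f x1 x2 y1 y2 k :
  (forall z, in_rectangle x1 x2 y1 y2 z -> cdiff f z) ->
  forall p q, x1 < p < x2 -> y1 < q < y2 ->
  (2 * pi)%:C * 'i * cderiv k f (p +i* q) =
  k`!%:R * cauchy_kernel f x1 x2 y1 y2 k (p +i* q).
Proof.
move=> df; elim: k => [|k IH] p q pp qq.
  rewrite fact0 mul1r -(cauchy_formula pp qq df) /cauchy_kernel.
  by congr boundary.
set a := p +i* q; pose c := (2 * pi)%:C * 'i : R[i].
have cn : normc c = 2 * pi.
  by rewrite normcM normc_i mulr1 normc_real ger0_norm// mulr_ge0// pi_ge0.
have cn0 : 0 < normc c by rewrite cn mulr_gt0// pi_gt0.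
have c0 : c != 0 by rewrite -normc_gt0.
pose l := c^-1 * (k.+1)`!%:R * cauchy_kernel f x1 x2 y1 y2 k.+1 a.
rewrite cderivS.
have -> : cderiv 1 (cderiv k f) a = l; last first.
  by rewrite -/c /l -mulrA mulVKf.
apply: (proj2 (normcP_cdiff _)) => e e0.
have [r [r0 _ [r1 r2] [r3 r4]]] := small_radius pp qq (@ltr01 R).
have fk0 : 0 < k`!%:R :> R by rewrite ltr0n fact_gt0.
have e'0 : 0 < e * normc c / k`!%:R by rewrite divr_gt0// mulr_gt0.
have [d d0 dP] := cauchy_kernel_expansion k pp qq df e'0.
exists (Num.min r d); first by rewrite lt_min r0.
move=> w; rewrite lt_min => /andP[wr wd].
have E : c * cderiv k f w = k`!%:R * cauchy_kernel f x1 x2 y1 y2 k w.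
  have := le_lt_trans (normc_Re _) wr; have := le_lt_trans (normc_Im _) wr.
  case: w {wr wd} => x y /=; rewrite !ltr_norml => /andP[? ?] /andP[? ?].
  by apply: IH; apply/andP; split; lra.
have Ea := IH p q pp qq.
rewrite -(ler_pM2l cn0) -normcM.
have -> : c * (cderiv k f w - cderiv k f a - l * (w - a)) =
   k`!%:R * (cauchy_kernel f x1 x2 y1 y2 k w - cauchy_kernel f x1 x2 y1 y2 k a -
      k.+1%:R * cauchy_kernel f x1 x2 y1 y2 k.+1 a * (w - a)).
  rewrite [LHS]mulrBr [X in X - _ = _]mulrBr E.
  rewrite -/a -/c in Ea; rewrite Ea /l factS natrM.
  move: (cauchy_kernel _ _ _ _ _ _ w) (cauchy_kernel _ _ _ _ _ k a)
    (cauchy_kernel _ _ _ _ _ k.+1 a) => u v s.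
  by field.
rewrite normcM normc_nat -ler_pdivlMl// (le_trans (dP _ wd))//.
by rewrite le_eqVlt; apply/orP; left; apply/eqP; field; rewrite gt_eqF.
Qed.

(** The constant 16 is 4 (see [boundary_le]) times 4, as the half perimeter is
    [4 r]; the factor [1 / (2 pi)] is estimated by 1. *)
Lemma cauchy_estimate f (p q r M : R) k : 0 < r -> (forall z, cdiff f z) ->
  (forall z, on_boundary (p - r) (p + r) (q - r) (q + r) z -> normc (f z) <= M) ->
  normc (cderiv k f (p +i* q)) <= 16 * k`!%:R * M / r ^+ k.
Proof.
move=> r0 df fM; set a := p +i* q.
have [p1 p2] : p - r < p /\ p < p + r by split; lra.
have [q1 q2] : q - r < q /\ q < q + r by split; lra.
have pp : p - r < p < p + r by rewrite p1 p2.
have qq : q - r < q < q + r by rewrite q1 q2.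
have E := @cderiv_cauchy f (p - r) (p + r) (q - r) (q + r) k
  (fun z _ => df z) p q pp qq.
have H : normc (cauchy_kernel f (p - r) (p + r) (q - r) (q + r) k a) <=
    4 * (M * r^-1 ^+ k.+1) * ((p + r - (p - r)) + (q + r - (q - r))).
  apply: boundary_le; [lra|lra| |].
    move=> z /(on_square_neq r0) za; apply: cdiffM => //.
    by apply: cdiffX; exact: cdiff_subV.
  move=> z zb; rewrite normcM; apply: ler_pM; rewrite ?normc_ge0//; first exact: fM.
  rewrite normcX lerXn2r ?nnegrE ?normc_ge0 ?invr_ge0 ?(ltW r0)//.
  have far : r <= normc (z - a) by apply: on_boundary_far zb; lra.
  rewrite normcV lef_pV2 ?posrE//; exact: lt_le_trans far.
have M0 : 0 <= M.
  apply: le_trans (fM ((p - r) +i* q) _); rewrite ?normc_ge0//.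
  by split => /=; [apply/andP; lra|apply/andP; lra|apply: Or41].
have pi1 := twopi_ge1 R.
have D0 := normc_ge0 (cderiv k f a).
apply: (@le_trans _ _ (2 * pi * normc (cderiv k f a))); first by rewrite ler_peMl.
have -> : 2 * pi * normc (cderiv k f a) = normc ((2 * pi)%:C * 'i * cderiv k f a).
  by rewrite 2!normcM normc_i mulr1 normc_real ger0_norm// mulr_ge0// pi_ge0.
rewrite E normcM normc_nat.
apply: le_trans (ler_wpM2l _ H) _ => //.
rewrite le_eqVlt; apply/orP; left; apply/eqP.
rewrite exprVn exprSr; field.
by rewrite ?gt_eqF ?exprn_gt0.
Qed.

End derivatives.

(** * Measure in the plane and choice of the rectangle *)

Section plane_measure.
Context {R : realType}.
Local Notation mu := (@lebesgue_measure R).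
Implicit Types (x y t a b c d : R).

(** A superlevel set is a union of squares with rational centre and rational
    radius, and there are countably many of them. *)
Lemma continuous_plane_measurable (h : R * R -> R) :
  (forall p e, 0 < e -> exists2 d : R, 0 < d &
     forall q, `|q.1 - p.1| < d -> `|q.2 - p.2| < d -> `|h q - h p| < e) ->
  measurable_fun [set: R * R] h.
Proof.
move=> ch _; apply: (measurability _ (RGenOInfty.measurableE R)) => //.
move=> /= _ [_ [r ->] <-]; rewrite setTI.
(* Centre (u, v) and radius s; tile discards the squares that leave the set. *)
pose box (u v s : rat) : set (R * R) :=
  `](ratr u - ratr s : R), (ratr u + ratr s : R)[ `*`
  `](ratr v - ratr s : R), (ratr v + ratr s : R)[.
pose inside (u v s : rat) := box u v s `<=` h @^-1` `]r, +oo[.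
pose tile u v s := if `[< inside u v s >] then box u v s else set0.
have -> : h @^-1` `]r, +oo[ =
    \bigcup_(u : rat) \bigcup_(v : rat) \bigcup_(s : rat) tile u v s.
  apply/seteqP; split=> [[x y]|p [u _ [v _ [s _]]]]; last first.
    by rewrite /tile; case: asboolP => // H; exact: H.
  rewrite /= in_itv/= andbT => rh.
  have e0 : 0 < h (x, y) - r by rewrite subr_gt0.
  have [d d0 dP] := ch (x, y) _ e0.
  have /rat_in_itvoo[s] : 0 < d / 2 by rewrite divr_gt0.
  rewrite in_itv/= => /andP[s0 sd].
  have /rat_in_itvoo[u] : x - ratr s < x + ratr s by lra.
  rewrite in_itv/= => /andP[u1 u2].
  have /rat_in_itvoo[v] : y - ratr s < y + ratr s by lra.
  rewrite in_itv/= => /andP[v1 v2].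
  exists u => //; exists v => //; exists s => //; rewrite /tile.
  case: asboolP => [_|[]].
    by split; rewrite /= in_itv/=; apply/andP; split; lra.
  move=> [x' y'] [/=]; rewrite !in_itv/= andbT => /andP[? ?] /andP[? ?].
  have : `|h (x', y') - h (x, y)| < h (x, y) - r.
    by apply: dP; rewrite /= ltr_norml; apply/andP; split; lra.
  by rewrite ltr_norml => /andP[? _]; lra.
apply: bigcupT_measurable_rat => u; apply: bigcupT_measurable_rat => v.
apply: bigcupT_measurable_rat => s; rewrite /tile; case: ifP => // _.
by apply: measurableX; exact: measurable_itv.
Qed.

(** A function that exceeds [M] on an interval of length 1 has integral at least
    [M]. *)
Lemma small_on_unit_interval (F : R -> \bar R) (M a : R) :
  measurable_fun setT F -> (forall x, (0 <= F x)%E) ->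
  (\int[mu]_x F x < M%:E)%E ->
  exists2 x, a <= x <= a + 1 & (F x <= M%:E)%E.
Proof.
move=> mF F0 FM; apply: contrapT => H.
have big x : a <= x <= a + 1 -> (M%:E <= F x)%E.
  move=> xx; rewrite leNgt; apply/negP => Fx; apply: H.
  by exists x => //; exact: ltW.
have M0 : 0 <= M.
  by rewrite -lee_fin; apply: le_trans (ltW FM); exact: integral_ge0.
suff: (M%:E <= \int[mu]_x F x)%E by rewrite leNgt FM.
apply: (@le_trans _ _ (\int[mu]_(x in `[a, (a + 1)%R]) F x)%E); last first.
  by apply: ge0_subset_integral => //; exact: measurable_itv.
apply: (@le_trans _ _ (\int[mu]_(x in `[a, (a + 1)%R]) (cst M%:E x))%E).
  rewrite [leRHS](_ : _ = M%:E * mu `[a, (a + 1)%R]%classic)%E; last first.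
    exact: (@integral_cst _ _ _ mu _ (measurable_itv _) M%:E).
  rewrite lebesgue_measure_itv/= lte_fin ltrDl ltr01 -EFinB -EFinM.
  by rewrite addrAC subrr add0r mulr1.
apply: ge0_le_integral => //=.
exact: measurable_funS mF.
Qed.

Lemma cint_le_weight phi (g : R -> R) (K M a b : R) : 0 <= K ->
  measurable_fun setT g -> (forall t, 0 <= g t) ->
  (\int[mu]_t (g t)%:E <= M%:E)%E -> cintegrable phi a b ->
  (forall t, a <= t <= b -> normc (phi t) <= K * g t) ->
  normc (cint phi a b) <= 2 * K * M.
Proof.
move=> K0 mg g0 gM phi_int phig; rewrite -lee_fin.
have mgS : measurable_fun `[a, b] g by exact: measurable_funS mg.
have mKg : measurable_fun `[a, b] (fun t => K * g t) by exact: measurable_funM.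
apply: le_trans (cint_le_integral phi_int mKg phig) _.
under eq_integral do rewrite EFinM.
rewrite ge0_integralZl_EFin//; last 2 first.
- by move=> t _; rewrite lee_fin.
- exact/measurable_EFinP.
rewrite muleA -EFinM [leRHS]EFinM; apply: lee_wpmul2l.
  by rewrite lee_fin mulr_ge0.
apply: le_trans gM; apply: ge0_subset_integral => //.
- exact/measurable_EFinP.
- by move=> t _; rewrite lee_fin.
Qed.

(** The integral over the plane is the integral of the integrals over lines
    parallel to either axis, so that each unit interval of abscissas
    or ordinates contains a line with integral at most [M]. *)
Lemma good_rectangle (g : R * R -> R) (M p q : R) :
  measurable_fun [set: R * R] g -> (forall p, 0 <= g p) ->
  (\int[mu \x mu]_z (g z)%:E < M%:E)%E ->
  exists x1 x2 y1 y2,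
    [/\ p - 2 <= x1 <= p - 1, p + 1 <= x2 <= p + 2, q - 2 <= y1 <= q - 1,
        q + 1 <= y2 <= q + 2 &
     [/\ (\int[mu]_y (g (x1, y))%:E <= M%:E)%E,
         (\int[mu]_y (g (x2, y))%:E <= M%:E)%E,
         (\int[mu]_x (g (x, y1))%:E <= M%:E)%E &
         (\int[mu]_x (g (x, y2))%:E <= M%:E)%E]].
Proof.
move=> mg g0 gM.
have mg' : measurable_fun setT (EFin \o g) by exact/measurable_EFinP.
have g0' z : (0 <= (EFin \o g) z)%E by rewrite lee_fin.
have FM := gM.
rewrite -[X in (X < _)%E]/(\int[mu \x mu]_z (EFin \o g) z)%E in FM.
rewrite fubini_tonelli1// in FM.
have GM := gM.
rewrite -[X in (X < _)%E]/(\int[mu \x mu]_z (EFin \o g) z)%E in GM.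
rewrite fubini_tonelli2// in GM.
have mF := @measurable_fun_fubini_tonelli_F _ _ _ _ _ mu _ mg' g0'.
have mG := @measurable_fun_fubini_tonelli_G _ _ _ _ _ mu _ mg' g0'.
have F0 x : (0 <= fubini_F mu (EFin \o g) x)%E by exact: integral_ge0.
have G0 x : (0 <= fubini_G mu (EFin \o g) x)%E by exact: integral_ge0.
have [x1 x1P X1] := small_on_unit_interval (p - 2) mF F0 FM.
have [x2 x2P X2] := small_on_unit_interval (p + 1) mF F0 FM.
have [y1 y1P Y1] := small_on_unit_interval (q - 2) mG G0 GM.
have [y2 y2P Y2] := small_on_unit_interval (q + 1) mG G0 GM.
exists x1, x2, y1, y2; split => //; apply/andP; split; lra.
Qed.

End plane_measure.

(** * The Fock space *)

Section fock_space.
Context {R : realType}.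
Local Notation mu := (@lebesgue_measure R).
Implicit Types (f : R[i] -> R[i]) (z w : R[i]).

Definition fock_density f (p : R * R) : R :=
  normc (f (p.1 +i* p.2)) ^+ 2 * expR (- normc (p.1 +i* p.2) ^+ 2).

Lemma fock_density_ge0 f p : 0 <= fock_density f p.
Proof. by rewrite mulr_ge0 ?exprn_ge0 ?normc_ge0 ?expR_ge0. Qed.

Lemma measurable_normc_entire f : (forall z, cdiff f z) ->
  measurable_fun [set: R * R] (fun p => normc (f (p.1 +i* p.2))).
Proof.
move=> df; apply: continuous_plane_measurable => -[x y] e e0 /=.
have [d d0 dP] := cdiff_cont (df (x +i* y)) e0.
exists (d / 2); first by rewrite divr_gt0.
move=> [x' y'] /= xx yy.
have /dP fe : normc (x' +i* y' - x +i* y) < d.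
  by apply: le_lt_trans (normc_le_ReIm _) _; rewrite complexB /=; lra.
apply: le_lt_trans fe; rewrite ler_norml; apply/andP; split.
- have := le_normcD (f (x' +i* y')) (f (x +i* y) - f (x' +i* y')).
  by rewrite addrC subrK normcB; lra.
- have := le_normcD (f (x +i* y)) (f (x' +i* y') - f (x +i* y)).
  by rewrite addrC subrK; lra.
Qed.

Lemma measurable_fock_density f : (forall z, cdiff f z) ->
  measurable_fun [set: R * R] (fock_density f).
Proof.
move=> df; apply: measurable_funM.
  by apply: measurable_funX; exact: measurable_normc_entire.
apply: (measurableT_comp (@measurable_expR R)).
apply: measurableT_comp => //; apply: measurable_funX.
by apply: (@measurable_normc_entire id) => z; exact: cdiff_id.
Qed.

(** The polynomial substitute for [|exp (- u)|^2 = exp (- 2 Re u)]: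
    [|1 - u/n|^2 = 1 - 2 Re u / n + |u|^2 / n^2], to which [1 + x <= exp x]
    applies; the condition on [n] makes the quadratic term cost at most a
    factor [e]. *)
Lemma normc_1subX (u : R[i]) n : normc u ^+ 2 <= n.+1%:R ->
  normc (1 - u / n.+1%:R) ^+ (2 * n.+1) <= expR (1 - 2 * Re u).
Proof.
case: u => a b; rewrite normc_sqr /= => un.
rewrite exprM.
have n0 : 0 < n.+1%:R :> R by [].
have -> : 1 - (a +i* b) / n.+1%:R = (1 - a / n.+1%:R) +i* (- (b / n.+1%:R)).
  have -> : (n.+1%:R : R[i]) = n.+1%:R%:C by rewrite -(rmorph_nat (real_complex R)).
  rewrite -fmorphV /= complexM; apply/eqP; rewrite eq_complex /=.
  by apply/andP; split; apply/eqP; ring.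
rewrite normc_sqr.
set t := n.+1%:R in un n0 *.
have -> : (1 - a / t) ^+ 2 + (- (b / t)) ^+ 2 =
    1 + ((a ^+ 2 + b ^+ 2) / t - 2 * a) / t.
  by field; rewrite gt_eqF.
apply: (@le_trans _ _ (expR (((a ^+ 2 + b ^+ 2) / t - 2 * a) / t) ^+ n.+1)).
  rewrite lerXn2r ?nnegrE ?expR_ge0 ?expR_ge1Dx//.
  have -> : 1 + ((a ^+ 2 + b ^+ 2) / t - 2 * a) / t =
      (1 - a / t) ^+ 2 + (b / t) ^+ 2.
    by field; rewrite gt_eqF.
  by rewrite addr_ge0// sqr_ge0.
rewrite -expRM_natl -/t mulrC divfK ?gt_eqF// ler_expR lerD2r.
by rewrite ler_pdivrMr// mul1r.
Qed.

Lemma normc_sqr_polarization z w :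
  normc z ^+ 2 = normc (z - w) ^+ 2 + 2 * Re ((z - w) * w^*) + normc w ^+ 2.
Proof. by case: z w => [a b] [c d]; rewrite complexB !normc_sqr /=; ring. Qed.

(** The estimate of [|f(w)|] by the norm, before taking square roots and before
    [M] tends to the integral. Cauchy's formula is applied to the square of
    the modified function, so that the integral of [|f|^2] appears without
    the Cauchy-Schwarz inequality. *)
Lemma fock_pointwise f (p q M : R) : (forall z, cdiff f z) ->
  (\int[mu \x mu]_z (fock_density f z)%:E < M%:E)%E ->
  normc (f (p +i* q)) ^+ 2 <= 8 * expR (9 + normc (p +i* q) ^+ 2) * M.
Proof.
move=> df fM; set w := p +i* q.
have [x1 [x2 [y1 [y2 [/andP[x11 x12] /andP[x21 x22]
    /andP[y11 y12] /andP[y21 y22] [X1 X2 Y1 Y2]]]]]] :=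
  good_rectangle p q (measurable_fock_density df) (fock_density_ge0 f) fM.
(* 8 bounds |z - w|^2 on the rectangle, hence 8 |w|^2 bounds |(z - w) conj w|^2. *)
pose n := Num.bound (8 * normc w ^+ 2).
have n8 : 8 * normc w ^+ 2 <= n.+1%:R.
  apply: ltW; apply: lt_le_trans (archi_boundP _) _; last by rewrite ler_nat leqnSn.
  by rewrite mulr_ge0// exprn_ge0// normc_ge0.
pose F z := (f z * (1 - (z - w) * w^* / n.+1%:R) ^+ n.+1) ^+ 2.
(* 9 = 8 + 1: the bound of |z - w|^2 and the loss in normc_1subX. *)
pose K := expR (9 + normc w ^+ 2).
have dF z : cdiff F z.
  apply: cdiffX; apply: cdiffM; first exact: df.
  apply: cdiffX; apply: cdiffB; first exact: cdiff_cst.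
  apply: cdiffM; last exact: cdiff_cst.
  apply: cdiffM; last exact: cdiff_cst.
  by apply: cdiffB; [exact: cdiff_id|exact: cdiff_cst].
have Fw : F w = f w ^+ 2 by rewrite /F subrr !mul0r subr0 expr1n mulr1.
have near_w x y : x1 <= x <= x2 -> y1 <= y <= y2 -> normc (x +i* y - w) ^+ 2 <= 8.
  move=> /andP[? ?] /andP[? ?]; rewrite /w complexB normc_sqr.
  have h1 : (x - p) ^+ 2 <= 4 by nra.
  have h2 : (y - q) ^+ 2 <= 4 by nra.
  by lra.
have FG x y : x1 <= x <= x2 -> y1 <= y <= y2 ->
    normc (F (x +i* y)) <= K * fock_density f (x, y).
  move=> xx yy; have zw := near_w x y xx yy.
  set z := x +i* y in zw *.
  have un : normc ((z - w) * w^*) ^+ 2 <= n.+1%:R.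
    have -> : normc ((z - w) * w^*) ^+ 2 = normc (z - w) ^+ 2 * normc w ^+ 2.
      by rewrite normcM exprMn; congr (_ * _); rewrite /w /= !normc_sqr sqrrN.
    by apply: le_trans n8; rewrite ler_wpM2r// exprn_ge0// normc_ge0.
  have := normc_1subX un.
  rewrite /F normcX normcM normcX exprMn -exprM mulnC => H.
  have -> : fock_density f (x, y) = normc (f z) ^+ 2 * expR (- normc z ^+ 2) by [].
  rewrite [leRHS]mulrCA; apply: ler_wpM2l; first by rewrite exprn_ge0// normc_ge0.
  apply: le_trans H _; rewrite /K -expRD ler_expR.
  by rewrite (normc_sqr_polarization z w); lra.
have pp : x1 < p < x2 by apply/andP; split; lra.
have qq : y1 < q < y2 by apply/andP; split; lra.
have xx : x1 <= x2 by lra.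
have yy : y1 <= y2 by lra.
have E := cauchy_formula pp qq (fun z _ => dF z).
pose Q z := F z * (z - w)^-1.
have dQ z : on_boundary x1 x2 y1 y2 z -> cdiff Q z.
  move=> zb; apply: cdiffM; first exact: dF.
  by apply: cdiff_subV; exact: (on_boundary_neq pp qq zb).
have QG x y : on_boundary x1 x2 y1 y2 (x +i* y) ->
    normc (Q (x +i* y)) <= K * fock_density f (x, y).
  move=> zb; have [/= xb yb _] := zb; apply: le_trans (FG x y xb yb).
  have far : 1 <= normc (x +i* y - w) by apply: on_boundary_far zb; lra.
  rewrite /Q normcM normcV ler_piMr ?normc_ge0// invf_le1//; exact: lt_le_trans far.
have [i1 i2 i3 i4] := boundary_sides xx yy dQ.
have K0 : 0 <= K by exact: expR_ge0.
have md := measurable_fock_density df.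
have d0 := fock_density_ge0 f.
have md1 y := measurable_fun_pair1 y md; have md2 x := measurable_fun_pair2 x md.
have H1 : normc (horizontal Q x1 x2 y1) <= 2 * K * M.
  apply: (cint_le_weight K0 (md1 _) (fun _ => d0 _) Y1 i1) => x xx'; apply: QG.
  by split => //=; [rewrite lexx yy|apply: Or43].
have H2 : normc (horizontal Q x1 x2 y2) <= 2 * K * M.
  apply: (cint_le_weight K0 (md1 _) (fun _ => d0 _) Y2 i2) => x xx'; apply: QG.
  by split => //=; [rewrite lexx yy|apply: Or44].
have V1 : normc (vertical Q x1 y1 y2) <= 2 * K * M.
  apply: (cint_le_weight K0 (md2 _) (fun _ => d0 _) X1 i3) => y yy'; apply: QG.
  by split => //=; [rewrite lexx xx|apply: Or41].
have V2 : normc (vertical Q x2 y1 y2) <= 2 * K * M.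
  apply: (cint_le_weight K0 (md2 _) (fun _ => d0 _) X2 i4) => y yy'; apply: QG.
  by split => //=; [rewrite lexx xx|apply: Or42].
have B : normc (boundary Q x1 x2 y1 y2) <= 8 * K * M.
  apply: le_trans (normc_boundary _ _ _ _ _) _.
  apply: le_trans (lerD (lerD (lerD H1 V2) H2) V1) _.
  by rewrite le_eqVlt; apply/orP; left; apply/eqP; ring.
have pi1 := twopi_ge1 R.
apply: le_trans B; rewrite [boundary Q _ _ _ _]E -/w Fw.
rewrite 2!normcM normc_i mulr1 normc_real normcX.
rewrite (ger0_norm (le_trans ler01 pi1)).
by rewrite ler_peMl// exprn_ge0// normc_ge0.
Qed.

End fock_space.

Theorem proposition5p1 (R : realType) :
  exists C : R,
    forall f : R[i] -> R[i], fock f ->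
    forall (k : nat) (z : R[i]),
      normc (cderiv k f z) <=
        C * k`!%:R * (1 + normc z) ^+ k * expR (normc z ^+ 2 / 2) * fock_norm f.
Proof.
pose C1 : R := Num.sqrt (8 * expR 9 * pi).
(* 8 e^9 is the constant of fock_pointwise and pi that of the norm; e^4 pays for
   moving from z to the boundary of the square of half side 1 / (1 + |z|). *)
exists (16 * C1 * expR 4) => f [df ffin] k [p q].
have {}df z : cdiff f z by exact: df.
pose I := (\int[(@lebesgue_measure R) \x (@lebesgue_measure R)]_z
  (fock_density f z)%:E)%E.
have I0 : (0 <= I)%E by apply: integral_ge0 => z _; rewrite lee_fin fock_density_ge0.
have NI : fock_sqnorm f = ((pi^-1)%:E * I)%E by [].
have Ifin : I \is a fin_num.
  rewrite ge0_fin_numE//; rewrite ltey; apply/eqP => Iy; move: ffin.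
  by rewrite NI Iy gt0_muley// lte_fin invr_gt0 pi_gt0.
have NE : fock_norm f = Num.sqrt (pi^-1 * fine I).
  by rewrite /fock_norm NI fineM.
have I0' : 0 <= fine I by exact: fine_ge0.
have pt w : normc (f w) <= C1 * expR (normc w ^+ 2 / 2) * fock_norm f.
  have H : normc (f w) ^+ 2 <= 8 * expR (9 + normc w ^+ 2) * fine I.
    apply/ler_addgt0Pr => e e0.
    have c0 : 0 < 8 * expR (9 + normc w ^+ 2) by rewrite mulr_gt0// expR_gt0.
    have : (I < (fine I + e / (8 * expR (9 + normc w ^+ 2)))%:E)%E.
      by rewrite -[ltLHS]fineK// lte_fin ltrDl divr_gt0.
    case: w c0 => x y c0 /(fock_pointwise x y df).
    rewrite mulrDr mulrCA divff ?mulr1//.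
    by rewrite gt_eqF.
  rewrite -(ler_pXn2r (ltn0Sn 1)) ?nnegrE ?normc_ge0//; last first.
    by rewrite !mulr_ge0 ?sqrtr_ge0 ?expR_ge0.
  apply: le_trans H _; rewrite NE !exprMn /C1 !sqr_sqrtr; last 2 first.
  - by rewrite mulr_ge0// invr_ge0 pi_ge0.
  - by rewrite !mulr_ge0 ?expR_ge0 ?pi_ge0.
  have -> : expR (normc w ^+ 2 / 2) ^+ 2 = expR (normc w ^+ 2).
    by rewrite -expRM_natl mulrCA divff// mulr1.
  rewrite expRD.
  rewrite le_eqVlt; apply/orP; left; apply/eqP.
  rewrite -[LHS]mulr1 -(@mulfV _ (@pi R)); last by rewrite gt_eqF ?pi_gt0.
  ring.
set z := p +i* q.
have z0 := normc_ge0 z.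
have z1 : 0 < 1 + normc z by rewrite ltr_wpDr.
pose r := (1 + normc z)^-1.
have r0 : 0 < r by rewrite invr_gt0.
have r1 : r <= 1 by rewrite invf_le1// lerDl.
have zr : normc z * r <= 1 by rewrite ler_pdivrMr// mul1r lerDr.
have fM u : on_boundary (p - r) (p + r) (q - r) (q + r) u ->
    normc (f u) <= C1 * (expR 4 * expR (normc z ^+ 2 / 2)) * fock_norm f.
  move=> ub; apply: le_trans (pt u) _.
  rewrite ler_wpM2r ?sqrtr_ge0// ler_wpM2l ?sqrtr_ge0// -expRD ler_expR.
  have uz : normc (u - z) <= 2 * r.
    apply: le_trans (normc_le_ReIm _) _; rewrite /z.
    case: u ub => x y [/= /andP[? ?] /andP[? ?] _].
    suff: `|x - p| <= r /\ `|y - q| <= r by move=> [? ?]; lra.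
    by rewrite !ler_norml; split; apply/andP; split; lra.
  have u1 : normc u <= normc z + 2 * r.
    by rewrite -[u](subrK z) addrC (le_trans (le_normcD _ _))// lerD2l.
  have u0 := normc_ge0 u.
  have : normc u ^+ 2 <= (normc z + 2 * r) ^+ 2.
    by rewrite ler_pXn2r ?nnegrE// addr_ge0// mulr_ge0// ltW.
  have : r ^+ 2 <= 1 by rewrite exprn_ile1// ltW.
  rewrite sqrrD exprMn; lra.
apply: le_trans (cauchy_estimate k r0 df fM) _.
rewrite /r exprVn invrK -/z.
by rewrite le_eqVlt; apply/orP; left; apply/eqP; ring.
Qed.
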